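(* Let $\lambda>-1$ and $t\in\mathbb{R}$ be fixed, and let $\beta_n(t;\lambda)$ be the recurrence coefficient in the three-term recurrence relation for the monic orthogonal polynomials with respect to the sextic Freud weight $\omega(x;t,\lambda)=|x|^{2\lambda+1}\exp(-x^6+tx^2)$, $x\in\mathbb{R}$. Put $\kappa=\sqrt[3]{60}$. Then $\beta_n(t;\lambda)$ has the following formal asymptotic expansions as $n\to\infty$: if $n$ is even, $$\beta_n(t;\lambda)=\frac{n^{1/3}}{\kappa}+\frac{t\kappa}{90n^{1/3}}-\frac{(2\lambda+1)\kappa^2}{90n^{2/3}}-\frac{4t(2\lambda+1)\kappa}{135n^{4/3}}-\frac{[t^3-135(7\lambda^2+7\lambda+2)]\kappa^2}{36450\,n^{5/3}}+\mathcal{O}(n^{-2}),$$ and if $n$ is odd, $$\beta_n(t;\lambda)=\frac{n^{1/3}}{\kappa}+\frac{t\kappa}{90n^{1/3}}+\frac{(2\lambda+1)\kappa^2}{60n^{2/3}}+\frac{7t(2\lambda+1)\kappa}{270n^{4/3}}-\frac{[2t^3+135(6\lambda^2+6\lambda+1)]\kappa^2}{72900\,n^{5/3}}+\mathcal{O}(n^{-2}).$$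
   Context: The weight is symmetric, so the monic orthogonal polynomials $P_n$ (with $\int_{-\infty}^\infty P_mP_n\,\omega\,dx=h_n\delta_{m,n}$, $h_n>0$) satisfy $P_{n+1}(x)=xP_n(x)-\beta_n(t;\lambda)P_{n-1}(x)$ with $P_{-1}=0$, $P_0=1$; here $\beta_n=h_n/h_{n-1}$ for $n\ge1$, and by convention $\beta_0=0$. *)

(* Defs.v *)
From HB Require Import structures.
From mathcomp Require Import all_boot all_order all_algebra.
From mathcomp Require Import all_classical all_reals all_analysis.

Set Implicit Arguments.
Unset Strict Implicit.
Unset Printing Implicit Defensive.

Import Order.TTheory GRing.Theory Num.Theory.
Import numFieldNormedType.Exports.

Local Open Scope classical_set_scope.
Local Open Scope ring_scope.

(* `0 `^ a` is 0 for a != 0 (and 1 for a = 0); the value at the single point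
   x = 0 does not affect any integral against the weight. *)
Definition sextic_freud_weight (R : realType) (t lambda x : R) : R :=
  `|x| `^ (2 * lambda + 1) * expR (- x ^+ 6 + t * x ^+ 2).

(* The orthogonality relations are stated in the extended reals, so that they
   assert that the integrals are finite. *)
Definition monic_orthogonal_polys (R : realType) (w : R -> R)
    (P : nat -> {poly R}) : Prop :=
  (forall n, P n \is monic /\ size (P n) = n.+1) /\
  exists h : nat -> R,
    (forall n, 0 < h n) /\
    (forall m n,
      (\int[@lebesgue_measure R]_x ((P m).[x] * (P n).[x] * w x)%:E)%E
      = (h n * (m == n)%:R)%:E).

(* Three-term recurrence of a symmetric weight, with P_{-1} = 0.  As each P_n
   is nonzero, beta is uniquely determined by P. *)
Definition recurrence_coeffs (R : realType) (P : nat -> {poly R})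
    (beta : nat -> R) : Prop :=
  [/\ beta 0%N = 0, P 0%N = 1 &
      forall n, P n.+1 =
        'X * P n - beta n *: (if n is m.+1 then P m else 0)].

Definition kappa (R : realType) : R := 60 `^ (1 / 3).

(* In the two expansions 36450 and 72900 are written 135 * 270 and 270 * 270,
   since a large numeral would denote a unary natural number. *)
Definition even_expansion (R : realType) (t lambda : R) (n : nat) : R :=
  n%:R `^ (1 / 3) / kappa R
  + t * kappa R / (90 * n%:R `^ (1 / 3))
  - (2 * lambda + 1) * kappa R ^+ 2 / (90 * n%:R `^ (2 / 3))
  - 4 * t * (2 * lambda + 1) * kappa R / (135 * n%:R `^ (4 / 3))
  - (t ^+ 3 - 135 * (7 * lambda ^+ 2 + 7 * lambda + 2)) * kappa R ^+ 2
      / (135 * 270 * n%:R `^ (5 / 3)).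

Definition odd_expansion (R : realType) (t lambda : R) (n : nat) : R :=
  n%:R `^ (1 / 3) / kappa R
  + t * kappa R / (90 * n%:R `^ (1 / 3))
  + (2 * lambda + 1) * kappa R ^+ 2 / (60 * n%:R `^ (2 / 3))
  + 7 * t * (2 * lambda + 1) * kappa R / (270 * n%:R `^ (4 / 3))
  - (2 * t ^+ 3 + 135 * (6 * lambda ^+ 2 + 6 * lambda + 1)) * kappa R ^+ 2
      / (270 * 270 * n%:R `^ (5 / 3)).

(* Main.v *)
(* The string equation for beta, obtained by integrating by parts against the
   weight, reads 6 G(beta_{n-2}, ..., beta_{n+2}) - 2 t beta_n
   = n + (2 lambda + 1) [n odd] for a cubic form G with positive coefficients.
   By positivity, beta_n / n^(1/3) is bounded, and Freud's comparison of its
   upper and lower limits shows that it converges to 1 / kappa.  The truncated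
   expansions satisfy the same equation up to a small residual, and the
   linearisation of G at the constant sequence has coefficients 1, 6, 16, 6, 1:
   since 16 > 1 + 6 + 6 + 1, the error at n is at most a fixed fraction of the
   errors at the neighbours plus O(n^-2).  An error of at most linear growth is
   then O(n^-2). *)
Require Import Defs.
From HB Require Import structures.
From mathcomp Require Import all_boot all_order all_algebra.
From mathcomp Require Import all_classical all_reals all_analysis.
From mathcomp Require Import measurable_realfun.
From mathcomp Require Import ring lra zify.

Set Implicit Arguments.
Unset Strict Implicit.
Unset Printing Implicit Defensive.

Import Order.TTheory GRing.Theory Num.Theory.
Import numFieldNormedType.Exports.

Local Open Scope classical_set_scope.
Local Open Scope ring_scope.

(** * Orthogonal polynomials for a Pearson functional *)

(** Around a centre m, all five coefficients are divided by the same cube root m^(1/3). As G is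
    homogeneous of degree 3, the string equation becomes a relation with the single parameter s =
    m^(-1/3), and the truncated expansions become polynomials in s up to O(s^7). The scaled error is
    s times the true one, so a residual of order s^7 costs s^6 = m^(-2). The constant kappa comes
    from 6 G(1, 1, 1, 1, 1) = 60. Convergence has to be known before the comparison: only near the
    constant sequence is the linearisation close enough to G for the factor 14/16 to survive. The
    room between 14/16 and 15/16 pays for the nonlinearity and the t-term, that between 15/16 and
    31/32 for the change of index within a window. Parity affects only lower-order terms, so one
    linearisation serves both parities. For lambda < -1/2 the weight is unbounded at 0; therefore
    the integration by parts is done on each half-line, on functions with a factor x. *)

Section OrthogonalFunctional.
Variables (R : realFieldType) (L : {poly R} -> R) (P : nat -> {poly R})
  (h beta : nat -> R).
Hypothesis LD : forall p q, L (p + q) = L p + L q.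
Hypothesis LZ : forall c p, L (c *: p) = c * L p.
Hypothesis P_monic : forall n, P n \is monic.
Hypothesis size_P : forall n, size (P n) = n.+1.
Hypothesis h_gt0 : forall n, 0 < h n.
Hypothesis L_orth : forall m n, L (P m * P n) = h n * (m == n)%:R.

Lemma functionalB (p q : {poly R}) : L (p - q) = L p - L q.
Proof. by rewrite LD -scaleN1r LZ mulN1r. Qed.

Lemma coef_monic_basis n : (P n)`_n = 1.
Proof. by have /monicP := P_monic n; rewrite /lead_coef size_P. Qed.

(** Expanding [q] over the basis, only its component along [P n] survives. The induction is on a
    second bound for the size of [q]; each step removes the multiple of [P k] that carries the
    coefficient of degree [k]. *)
Lemma orthogonal_coef n (q : {poly R}) : (size q <= n.+1)%N -> L (q * P n) = q`_n * h n.
Proof.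
move=> sq; have := leqnn (size q); move: {2}(size q) => k.
elim: k q sq => [|k IHk] q sq szk.
  move: szk; rewrite leqn0 size_poly_eq0 => /eqP->.
  by rewrite mul0r coef0 -[0 : {poly R}](scale0r 1) LZ !mul0r.
have [lenk|ltkn] := ltnP n k.
  by apply: IHk => //; apply: leq_trans sq _.
pose q1 := q - q`_k *: P k.
have szq1 : (size q1 <= k)%N.
  apply/leq_sizeP => j; rewrite leq_eqVlt => /predU1P[<-|ltkj].
    by rewrite coefB coefZ coef_monic_basis mulr1 subrr.
  rewrite coefB coefZ [q`_j]nth_default ?(leq_trans szk) //.
  by rewrite [(P k)`_j]nth_default ?size_P // mulr0 subr0.
have -> : q * P n = (q`_k *: P k + q1) * P n by rewrite /q1 addrC subrK.
rewrite mulrDl LD -scalerAl LZ L_orth IHk ?(leq_trans szq1) 1?leqW //.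
have -> : q1`_n = 0 by rewrite nth_default ?(leq_trans szq1).
rewrite mul0r addr0; have [->|neqkn] := eqVneq k n; first by rewrite mulr1.
rewrite !mulr0 nth_default ?mul0r //.
by apply: leq_trans szk _; rewrite ltn_neqAle neqkn.
Qed.

Hypothesis P_rec : forall n,
  P n.+1 = 'X * P n - beta n *: (if n is m.+1 then P m else 0).

Lemma recurrence_mulX n : 'X * P n.+1 = P n.+2 + beta n.+1 *: P n.
Proof. by rewrite [P n.+2]P_rec subrK. Qed.

(** Both sides are the value of [L] at x P_n P_{n+1}: x P_n is monic of degree n + 1, and x P_{n+1}
    has component [beta n.+1] along [P n]. *)
Lemma recurrence_norm n : h n.+1 = beta n.+1 * h n.
Proof.
have szXP : (size ('X * P n)%R <= n.+2)%N.
  by rewrite mulrC size_mulX ?size_P // -size_poly_eq0 size_P.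
have H1 : L ('X * P n * P n.+1) = h n.+1.
  by rewrite orthogonal_coef // coefXM /= coef_monic_basis mul1r.
have : L ('X * P n.+1 * P n) = beta n.+1 * h n.
  rewrite recurrence_mulX mulrDl LD -scalerAl LZ !L_orth eqxx mulr1.
  by rewrite gtn_eqF ?mulr0 ?add0r.
by move=> <-; rewrite -H1; congr L; rewrite -!mulrA (mulrC (P n)).
Qed.

Lemma recurrence_coeff_gt0 n : 0 < beta n.+1.
Proof. by rewrite -(pmulr_lgt0 _ (h_gt0 n)) -recurrence_norm. Qed.

(** At 0 the recurrence only links indices at distance two, and [P 1] vanishes there. *)
Lemma root0_odd n : (P n.*2.+1).[0] = 0.
Proof.
elim: n => [|n IHn]; rewrite ?doubleS P_rec hornerD hornerN hornerM hornerX.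
  by rewrite mul0r hornerZ horner0 mulr0 subr0.
by rewrite mul0r hornerZ IHn mulr0 subr0.
Qed.

Lemma X_dvd_odd n : exists q, P n.*2.+1 = 'X * q.
Proof.
have /factor_theorem[q ->] : root (P n.*2.+1) 0 by rewrite /root root0_odd.
by exists q; rewrite subr0 mulrC.
Qed.

Variables (rho t : R).
(* Pearson: the weight satisfies (x w)' = (rho + 1 + 2 t x^2 - 6 x^6) w. *)
Hypothesis L_pearson : forall r : {poly R},
  L (('X * r)^`() + rho *: r + 'X * r * ((2 * t) *: 'X - 6 *: 'X^5)) = 0.

(** Of the two terms of the product rule, the one with the derivative of [P n] vanishes by degree;
    the other contributes the leading coefficient n + 1. This is the origin of the term n in the
    string equation. *)
Lemma orthogonal_deriv n : L ((P n.+1 * P n)^`()) = n.+1%:R * h n.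
Proof.
have szd m : (size ((P m)^`()) <= m)%N.
  by rewrite (leq_trans (size_poly _ _)) ?size_P.
rewrite derivM LD orthogonal_coef // coef_deriv coef_monic_basis.
rewrite [P n.+1 * _]mulrC orthogonal_coef; last first.
  by rewrite (leq_trans (szd n)) // ltnW.
by rewrite [(P n)^`()`__]nth_default ?(leq_trans (szd n)) // mul0r addr0.
Qed.

(** The origin of the parity term. Of two consecutive polynomials, one has odd degree and is
    divisible by ['X]. If it is [P n.+1], the quotient is monic of degree n and pairs with [P n] to
    [h n]; if it is [P n], the quotient has too low a degree to meet [P n.+1]. *)
Lemma orthogonal_divX n :
  exists2 r, P n.+1 * P n = 'X * r & L r = (odd n.+1)%:R * h n.
Proof.
rewrite -[n]odd_double_half; case: (odd n) => /=.
  rewrite add1n odd_double /=.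
  have [q Eq] := X_dvd_odd n./2.
  exists (P n./2.*2.+2 * q); first by rewrite Eq mulrCA.
  have szq : (size q <= n./2.*2.+1)%N.
    have := size_P n./2.*2.+1.
    have q0 : q != 0.
      apply: contraTneq (P_monic n./2.*2.+1) => q0.
      by rewrite Eq q0 mulr0 monicE lead_coef0 eq_sym oner_eq0.
    by rewrite Eq mulrC size_mulX // => -[->].
  rewrite mulrC orthogonal_coef; last exact/ltnW/ltnW.
  by rewrite nth_default ?mul0r //; apply: ltnW.
rewrite add0n odd_double /=.
have [q Eq] := X_dvd_odd n./2.
exists (q * P n./2.*2); first by rewrite Eq mulrA.
have Cq k : q`_k = (P n./2.*2.+1)`_k.+1 by rewrite Eq coefXM.
rewrite orthogonal_coef ?Cq ?coef_monic_basis //.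
by apply/leq_sizeP => j lej; rewrite Cq nth_default // size_P.
Qed.

Lemma orthogonal_mul3 n (c1 c2 c3 d1 d2 : R) :
  L ((P n.+2.+4 + c1 *: P n.+4 + c2 *: P n.+2 + c3 *: P n)
     * (P n.+4 + d1 *: P n.+2 + d2 *: P n))
  = c1 * h n.+4 + c2 * d1 * h n.+2 + c3 * d2 * h n.
Proof.
rewrite [X in L X](_ : _ = P n.+2.+4 * P n.+4 + d1 *: (P n.+2.+4 * P n.+2)
  + d2 *: (P n.+2.+4 * P n) + c1 *: (P n.+4 * P n.+4)
  + (c1 * d1) *: (P n.+4 * P n.+2) + (c1 * d2) *: (P n.+4 * P n)
  + c2 *: (P n.+2 * P n.+4) + (c2 * d1) *: (P n.+2 * P n.+2)
  + (c2 * d2) *: (P n.+2 * P n) + c3 *: (P n * P n.+4)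
  + (c3 * d1) *: (P n * P n.+2) + (c3 * d2) *: (P n * P n)); last first.
  by rewrite -!mul_polyC !rmorphM /=; ring.
have gt k : (n + k.+1 == n)%N = false by lia.
have lt k : (n == n + k.+1)%N = false by lia.
have := (gt 1%N, gt 3%N, gt 5%N, lt 1%N, lt 3%N); rewrite !addnS !addn0 => neq.
by rewrite !LD !LZ !L_orth !eqSS !neq !eqxx /=; ring.
Qed.

(** The Pearson relation is tested on the [r] with x r = P_{n+3} P_{n+2}. The factor x^5 is shared
    as x^3 P_{n+3} times x^2 P_{n+2}, whose expansions involve only indices of the parity of n; both
    reach down exactly to [P n], which is why the centre is [n.+3]. *)
Lemma string_equation n (b := fun k => beta (n + k)%N) :
  6 * b 3%N * (b 1%N * b 2%N + b 2%N ^+ 2 + 2 * b 2%N * b 3%N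
     + b 2%N * b 4%N + b 3%N ^+ 2 + 2 * b 3%N * b 4%N + b 4%N ^+ 2
     + b 4%N * b 5%N) - 2 * t * b 3%N
  = n.+3%:R + rho * (odd n.+3)%:R.
Proof.
have X3 : 'X ^+ 3 * P n.+3 = P n.+2.+4 + (b 3%N + b 4%N + b 5%N) *: P n.+4
   + (b 3%N * (b 4%N + b 3%N + b 2%N)) *: P n.+2
   + (b 3%N * b 2%N * b 1%N) *: P n.
  have -> : 'X ^+ 3 * P n.+3 = 'X * ('X * ('X * P n.+3)) by ring.
  rewrite !(recurrence_mulX, mulrDr, scalerDr, =^~ scalerAr).
  rewrite /b !addnS addn0 -!mul_polyC !rmorphM !rmorphD /=; ring.
have X2 : 'X ^+ 2 * P n.+2 = P n.+4 + (b 3%N + b 2%N) *: P n.+2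
   + (b 2%N * b 1%N) *: P n.
  have -> : 'X ^+ 2 * P n.+2 = 'X * ('X * P n.+2) by ring.
  rewrite !(recurrence_mulX, mulrDr, scalerDr, =^~ scalerAr).
  rewrite /b !addnS addn0 -!mul_polyC !rmorphM !rmorphD /=; ring.
have X1 : L ('X * P n.+2 * P n.+3) = h n.+3.
  rewrite recurrence_mulX mulrDl LD -scalerAl LZ !L_orth eqxx mulr1.
  by rewrite ltn_eqF ?mulr0 ?addr0.
have [r Er Lr] := orthogonal_divX n.+2.
have := L_pearson r; rewrite -Er !LD orthogonal_deriv LZ Lr.
have -> : P n.+3 * P n.+2 * ((2 * t) *: 'X - 6 *: 'X^5)
  = (2 * t) *: ('X * P n.+2 * P n.+3)
    - 6 *: (('X ^+ 3 * P n.+3) * ('X ^+ 2 * P n.+2)).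
  rewrite -!mul_polyC; ring.
rewrite functionalB !LZ X1 X3 X2 orthogonal_mul3.
have hE k : h (n + k).+1 = b k.+1 * h (n + k)%N.
  by rewrite recurrence_norm /b addnS.
have := hE 0%N; have := hE 1%N; have := hE 2%N; have := hE 3%N.
rewrite !addnS !addn0 => h4 h3 h2 h1 E.
(* All norms are now multiples of [h n]; the claim is the Pearson relation divided by [h n.+2]. *)
have hn2 : h n.+2 != 0 by rewrite gt_eqF.
apply: (mulIf hn2); apply/eqP; rewrite -subr_eq0 -[X in _ == X]oppr0 -E.
apply/eqP; rewrite h4 h3 h2 h1; ring.
Qed.
End OrthogonalFunctional.

(** * Integration against the sextic Freud weight *)

(** The integral is the difference of those of the positive and negative parts. A finite difference
    forces both to be finite, because in the extended reals [+oo - +oo] is infinite as well. *)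
Lemma fin_num_integrable d (T : measurableType d) (R : realType)
    (mu : {measure set T -> \bar R}) (D : set T) (f : T -> \bar R) :
  measurable D -> measurable_fun D f -> (\int[mu]_(x in D) f x)%E \is a fin_num ->
  mu.-integrable D f.
Proof.
move=> mD mf fin; apply/integrableP; split=> //.
rewrite -/(abse \o f) fune_abse ge0_integralD //;
  [|exact/measurable_funepos|exact/measurable_funeneg].
have pge0 : (0 <= \int[mu]_(x in D) f^\+ x)%E by exact: integral_ge0.
have nge0 : (0 <= \int[mu]_(x in D) f^\- x)%E by exact: integral_ge0.
move: fin pge0 nge0; rewrite integralE.
move: (\int[mu]_(x in D) f^\+ x)%E (\int[mu]_(x in D) f^\- x)%E.
by move=> [a| |] [b| |] //= _ _ _; rewrite -EFinD ltry.
Qed.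

Section SexticFreudWeight.
Variables (R : realType) (t lambda : R).
Notation w := (sextic_freud_weight t lambda).
Notation mu := (@lebesgue_measure R).
Notation rho := (2 * lambda + 1).

Lemma measurable_sextic_freud_weight : measurable_fun setT w.
Proof.
apply: measurable_funM.
  apply: (measurableT_comp (measurable_powR rho)); exact: normr_measurable.
apply: measurableT_comp; first exact: measurable_expR.
rewrite (_ : (fun x => _) = horner (- 'X^6 + t *: 'X^2)).
  by apply: continuous_measurable_fun; exact: continuous_horner.
by apply/funext => x; rewrite hornerD hornerN hornerZ !hornerXn.
Qed.

Lemma measurable_poly_weight (p : {poly R}) :
  measurable_fun setT (fun x => p.[x] * w x).
Proof.
apply: measurable_funM; last exact: measurable_sextic_freud_weight.
by apply: continuous_measurable_fun; exact: continuous_horner.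
Qed.

(** The relation between [P n] and [P 0 = 1] says that the integral of P_n w is finite, hence P_n w
    is integrable. Removing leading terms extends this to every polynomial. *)
Lemma integrable_poly_weight (P : nat -> {poly R}) :
  monic_orthogonal_polys w P -> P 0%N = 1 ->
  forall p : {poly R}, mu.-integrable setT (EFin \o (fun x => p.[x] * w x)).
Proof.
move=> [Pms [h [_ orth]]] P0.
have iP n : mu.-integrable setT (EFin \o (fun x => (P n).[x] * w x)).
  apply: fin_num_integrable => //.
    by apply/measurable_EFinP; exact: measurable_poly_weight.
  have := orth n 0%N; rewrite P0 -polyC1.
  under [X in X = _]eq_integral do rewrite hornerC mulr1.
  by rewrite /comp => ->.
move=> p; have [k] := ubnP (size p); elim: k p => // k IHk p szp.
have [p0|p0] := eqVneq (size p) 0%N.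
  move/eqP: p0; rewrite size_poly_eq0 => /eqP->.
  rewrite (_ : EFin \o _ = cst 0%E); first exact: integrable0.
  by apply/funext => x /=; rewrite horner0 mul0r.
pose m := (size p).-1; pose q := p - lead_coef p *: P m.
have szp1 : size p = m.+1 by rewrite prednK // lt0n.
have szq : (size q < k)%N.
  apply: leq_ltn_trans (_ : m < k)%N; last by move: szp; rewrite szp1.
  have [Pm szP] := Pms m.
  apply/leq_sizeP => j; rewrite leq_eqVlt => /predU1P[<-|ltmj].
    have : (P m)`_m = 1 by move/monicP: Pm; rewrite /lead_coef szP.
    by rewrite coefB coefZ lead_coefE -/m => ->; rewrite mulr1 subrr.
  by rewrite coefB coefZ !nth_default ?mulr0 ?subrr ?szP ?szp1.
pose f p0 := EFin \o (fun x => (p0 : {poly R}).[x] * w x).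
rewrite (_ : EFin \o _ = (f q \+ (fun x => (lead_coef p)%:E * f (P m) x))%E).
  by apply: integrableD => //; [exact: IHk|apply: integrableZl => //; exact: iP].
apply/funext => x; rewrite /f /= -EFinM -EFinD; congr EFin.
by rewrite /q hornerD hornerN hornerZ; ring.
Qed.

Lemma is_derive_weight (x : R) : x != 0 ->
  is_derive x (1 : R) w ((rho / x + (2 * t * x - 6 * x ^+ 5)) * w x).
Proof.
move=> x0.
(* As a power of y^2, the singular factor is differentiated once for both signs of x. *)
have normE (y : R) : `|y| `^ rho = (y ^+ 2) `^ (2^-1 * rho).
  by rewrite powRrM powR12_sqrt ?sqr_ge0 // sqrtr_sqr.
have -> : w = (((@powR R ^~ (2^-1 * rho)) \o horner 'X^2)
   * (expR \o horner (- 'X^6 + t *: 'X^2)))%R.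
  apply/funext => y; rewrite /sextic_freud_weight normE /=.
  rewrite /GRing.mul /= hornerXn; congr (_ * expR _).
  by rewrite hornerD hornerN hornerZ !hornerXn.
have x20 : 0 < ('X^2).[x] by rewrite hornerXn exprn_even_gt0.
have D1 := is_derive1_comp (is_derive1_powR (2^-1 * rho) x20) (is_derive_poly 'X^2 x).
have D2 := is_derive1_comp (is_derive_expR _) (is_derive_poly (- 'X^6 + t *: 'X^2) x).
apply: is_derive_eq (is_deriveM D1 D2) _.
set u := (_ \o _) x; set e := (expR \o _) x.
rewrite -[(_ * _)%R x]/(u * e) -[u *: _]/(u * _) -[e *: _]/(e * _).
have -> : ('X^2).[x] `^ (2^-1 * rho - 1) = u / x ^+ 2.
  rewrite powRB; last by rewrite (gt_eqF x20) implybT.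
  by rewrite powRr1 ?ltW // /u /= hornerXn.
rewrite -[expR (- 'X^6 + t *: 'X^2).[x]]/e derivD derivN derivZ !derivXn !hornerE /=.
by field.
Qed.

(** The polynomial with (x r w)' = [pearson_poly r] w away from 0; the factor x cancels the pole of
    rho / x in w' / w. *)
Definition pearson_poly (r : {poly R}) : {poly R} :=
  ('X * r)^`() + rho *: r + 'X * r * ((2 * t) *: 'X - 6 *: 'X^5).

Lemma is_derive_poly_weight (r : {poly R}) (x : R) : x != 0 ->
  is_derive x (1 : R) (fun y => ('X * r).[y] * w y) ((pearson_poly r).[x] * w x).
Proof.
move=> x0; apply: is_derive_eq (is_deriveM (is_derive_poly ('X * r) x)
  (is_derive_weight x0)) _.
rewrite -[_ *: _]/(('X * r).[x] * _) -[w x *: _]/(w x * _).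
move: (w x) => wx; rewrite /pearson_poly !(hornerD, hornerN, hornerZ, hornerM, hornerX, hornerXn).
by field.
Qed.

Lemma continuous_poly_weight (p : {poly R}) (x : R) : x != 0 ->
  {for x, continuous (fun y => p.[y] * w y)}.
Proof.
move=> x0; apply: cvgM; first exact: continuous_horner.
have [dw _] := is_derive_weight x0.
exact/differentiable_continuous/derivable1_diffP.
Qed.

Lemma integral_pearson_itv (r : {poly R}) (a b : R) : a < b -> 0 < a \/ b < 0 ->
  (\int[mu]_(x in `[a, b]) ((pearson_poly r).[x] * w x)%:E
   = (('X * r).[b] * w b - ('X * r).[a] * w a)%:E)%E.
Proof.
move=> ab h0; have nz x : x \in `[a, b] -> x != 0.
  by rewrite in_itv /= => /andP[ax xb]; case: h0 => h0; apply: contraTneq isT => x0;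
    move: ax xb; rewrite x0; lra.
have aI : a \in `[a, b] by rewrite in_itv /= lexx ltW.
have bI : b \in `[a, b] by rewrite in_itv /= lexx ltW.
rewrite EFinB; apply: (continuous_FTC2 (F := fun y => ('X * r).[y] * w y)) => //.
- apply: continuous_in_subspaceT => x /set_mem xI.
  by apply: continuous_poly_weight; exact: nz.
- split.
  + move=> x xI; have x0 : x != 0 by apply: nz; exact: subset_itv_oo_cc.
    by have [] := is_derive_poly_weight r x0.
  + by apply: cvg_at_right_filter; apply: continuous_poly_weight; exact: nz.
  + by apply: cvg_at_left_filter; apply: continuous_poly_weight; exact: nz.
- move=> x xI; have x0 : x != 0 by apply: nz; exact: subset_itv_oo_cc.
  by rewrite derive1E; have [_ ->] := is_derive_poly_weight r x0.
Qed.

End SexticFreudWeight.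

(** * Vanishing of the boundary terms and the Pearson identity *)

Section PearsonIdentity.
Variables (R : realType) (t lambda : R).
Notation w := (sextic_freud_weight t lambda).
Notation mu := (@lebesgue_measure R).
Notation rho := (2 * lambda + 1).
Notation pearson_poly := (pearson_poly t lambda).

Lemma poly_bound (p : {poly R}) :
  exists2 C, 0 <= C & forall x, 1 <= x -> `|p.[x]| <= C * x ^+ size p.
Proof.
exists (\sum_(i < size p) `|p`_i|); first exact: sumr_ge0.
move=> x x1; rewrite horner_coef mulr_suml.
apply: le_trans (ler_norm_sum _ _ _) _; apply: ler_sum => i _.
rewrite normrM ler_wpM2l // normrX ger0_norm ?(le_trans ler01) //.
by rewrite ler_weXn2l // ltnW.
Qed.

(** For x >= 1 + |t| the weight is at most x^m exp(-x), and the exponential series beats every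
    power. The cutoff n + 2 is used so that 1 / (n + 2) < n + 2 holds already at n = 0. *)
Lemma cvg_poly_weight_infty (p : {poly R}) :
  (fun n : nat => p.[n.+2%:R] * w n.+2%:R) @ \oo --> 0.
Proof.
have [C C0 pC] := poly_bound p.
have [m rhom] : exists m : nat, rho <= m%:R.
  exists (Num.bound `|rho|); apply: le_trans (ler_norm _) _.
  by apply: ltW; exact: archi_boundP.
pose k := (size p + m)%N.
have dom x : 1 + `|t| <= x ->
    `|p.[x] * w x| <= C * (k.+1)`!%:R * x^-1.
  move=> tx; have x1 : 1 <= x by apply: le_trans tx; rewrite lerDl.
  have x0 : 0 < x by apply: lt_le_trans x1.
  rewrite normrM [`|w x|]ger0_norm; last first.
    by rewrite mulr_ge0 ?powR_ge0 ?expR_ge0.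
  have w1 : w x <= x ^+ m * expR (- x).
    rewrite /sextic_freud_weight; apply: ler_pM; rewrite ?powR_ge0 ?expR_ge0 //.
      rewrite gtr0_norm //; apply: le_trans (ler_powR x1 rhom) _.
      by rewrite powR_mulrn // ltW.
    have x2 : x <= x ^+ 2 by exact: ler_eXnr.
    have x4 : x <= x ^+ 4 by exact: ler_eXnr.
    (* This gives -x^6 + t x^2 <= -x^2 <= -x. *)
    have : 0 <= x ^+ 2 * (x ^+ 4 - 1 - t).
      by apply: mulr_ge0; [exact: sqr_ge0|have := ler_norm t; lra].
    by rewrite ler_expR; lra.
  apply: (@le_trans _ _ (C * x ^+ size p * (x ^+ m * expR (- x)))).
    by apply: ler_pM => //; [rewrite mulr_ge0 ?powR_ge0 ?expR_ge0|exact: pC].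
  have -> : C * x ^+ size p * (x ^+ m * expR (- x)) = C * (x ^+ k * expR (- x)).
    by rewrite exprD; ring.
  rewrite -mulrA ler_wpM2l // ler_pdivlMr // expRN mulrAC -exprSr.
  rewrite ler_pdivrMr ?expR_gt0 //.
  have := expR_ge1Dxn k (ltW x0); rewrite -lerBrDl => H.
  have : x ^+ k.+1 / (k.+1)`!%:R <= expR x.
    by apply: le_trans H _; rewrite lerBlDl lerDr.
  by rewrite ler_pdivrMr ?ltr0n ?fact_gt0 // mulrC.
apply/norm_cvg0P; apply: (@squeeze_cvgr _ _ _ _ (cst 0)
    (fun n : nat => C * (k.+1)`!%:R * (n.+2%:R)^-1)).
- near=> n; rewrite normr_ge0 /=; apply: dom.
  near: n; have [N _ HN] := nbhs_infty_ger (1 + `|t|).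
  exists N => // n /= Nn; apply: le_trans (HN n Nn) _.
  by rewrite ler_nat leqW // leqW.
- exact: cvg_cst.
- rewrite -[X in _ --> X](mulr0 (C * (k.+1)`!%:R)); apply: cvgMr.
  by move: (@cvg_harmonic R); rewrite -(cvg_shiftS (@harmonic R)).
Unshelve. all: by end_near. Qed.

Hypothesis lambda_gt : -1 < lambda.

(** The function behaves like x^(rho + 1) r(0) at 0, and rho + 1 = 2 lambda + 2 is positive; this is
    where [-1 < lambda] enters. *)
Lemma cvg_poly_weight_0 (r : {poly R}) :
  (fun n : nat => ('X * r).[(n.+2%:R)^-1] * w (n.+2%:R)^-1) @ \oo --> 0.
Proof.
have H : (fun x => ('X * r).[x] * w x) @ 0^'+ --> 0.
  pose g x := x `^ (rho + 1) * (r.[x] * expR (- 'X^6 + t *: 'X^2).[x]).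
  apply: (@cvg_trans _ (g @ 0^'+)).
    apply: near_eq_cvg; near=> x.
    have x0 : 0 < x by near: x; exact: nbhs_right_gt.
    rewrite /g /sextic_freud_weight powRD ?(gt_eqF x0) ?implybT //.
    rewrite powRr1 ?ltW // gtr0_norm //.
    rewrite !(hornerD, hornerN, hornerZ, hornerM, hornerX, hornerXn); ring.
  suff : g @ 0^'+ --> 0 * (r.[0] * expR (- 'X^6 + t *: 'X^2).[0]) by rewrite mul0r.
  have rho1 : 0 < rho + 1 by move: lambda_gt; lra.
  apply: cvgM; first exact: powR_cvg0.
  apply: cvgM; apply: cvg_at_right_filter; first exact: continuous_horner.
  apply: (@continuous_comp _ _ _ (horner (- 'X^6 + t *: 'X^2)) (@expR R)).
    exact: continuous_horner.
  exact: continuous_expR.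
move/cvg_at_rightP: H; apply; split=> [n|]; first by rewrite invr_gt0.
by move: (@cvg_harmonic R); rewrite -(cvg_shiftS (@harmonic R)).
Unshelve. all: by end_near. Qed.

(** On each cutoff interval the integral is a difference of boundary terms, which tends to 0;
    dominated convergence identifies the limit with the integral over [D], later a half-line. *)
Lemma integral_pearson_cutoff (r : {poly R}) (D : set R) (a b : nat -> R) :
  measurable D ->
  mu.-integrable setT (EFin \o (fun x => (pearson_poly r).[x] * w x)) ->
  (forall n, a n < b n) -> (forall n, 0 < a n \/ b n < 0) ->
  (forall n, `[a n, b n] `<=` D) ->
  (forall x, D x -> \forall n \near \oo, x \in `[a n, b n]) ->
  (fun n => ('X * r).[b n] * w (b n)) @ \oo --> 0 ->
  (fun n => ('X * r).[a n] * w (a n)) @ \oo --> 0 ->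
  (\int[mu]_(x in D) ((pearson_poly r).[x] * w x)%:E = 0)%E.
Proof.
move=> mD fint ab ab0 abD Dab Fb Fa.
pose f := EFin \o (fun x => (pearson_poly r).[x] * w x).
have mf : measurable_fun setT f by case/integrableP: fint.
have mfr A : measurable A -> measurable_fun setT (f \_ A).
  move=> mA; apply/measurable_restrict => //.
  by apply: measurable_funS mf.
have H1 n : measurable_fun setT (f \_ `[a n, b n]) by exact: mfr.
have H2 : measurable_fun setT (f \_ D) by exact: mfr.
have H3 : {ae mu, forall x, setT x -> (f \_ `[a n, b n]) x @[n --> \oo] --> (f \_ D) x}.
  apply: aeW => /= x _; have [Dx|nDx] := pselect (D x).
    apply: cvg_near_cst; have [N _ HN] := Dab x Dx.
    exists N => // n /= Nn; rewrite !patchE (mem_set Dx) mem_set //.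
    exact: HN.
  apply: cvg_near_cst; apply: nearW => n; rewrite !patchE !memNset //.
  by move=> abx; apply: nDx; exact: abD abx.
have H4 : mu.-integrable setT (abse \o f) by exact: integrable_abse.
have H5 : {ae mu, forall x n, setT x -> (`|(f \_ `[a n, b n]) x| <= (abse \o f) x)%E}.
  apply: aeW => /= x n _; rewrite patchE; case: ifP => // _.
  by rewrite abse0.
have [_ _ lim_] := @dominated_convergence _ _ _ mu _ measurableT _ _ _ H1 H2 H3 H4 H5.
rewrite integral_mkcond.
apply: (cvg_unique (@ereal_hausdorff R) lim_).
rewrite (_ : [sequence _]_n = fun n =>
  (('X * r).[b n] * w (b n) - ('X * r).[a n] * w (a n))%:E); last first.
  by apply/funext => n /=; rewrite -integral_mkcond integral_pearson_itv.
apply: cvg_EFin; first exact: nearW.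
have FbFa := cvgB Fb Fa; rewrite subr0 in FbFa; exact: FbFa.
Qed.

Lemma pearson_identity (r : {poly R}) :
  mu.-integrable setT (EFin \o (fun x => (pearson_poly r).[x] * w x)) ->
  (\int[mu]_x ((pearson_poly r).[x] * w x)%:E = 0)%E.
Proof.
move=> fint.
have mf : measurable_fun setT (EFin \o (fun x => (pearson_poly r).[x] * w x)).
  by case/integrableP: fint.
have lt_inv n : (n.+2%:R)^-1 < n.+2%:R :> R.
  apply: (@lt_trans _ _ 1); last by rewrite ltr1n.
  by rewrite invf_lt1 ?ltr0n // ltr1n.
have inv_gt0 n : 0 < (n.+2%:R)^-1 :> R by rewrite invr_gt0.
have near_itv (x : R) : 0 < x ->
    \forall n \near \oo, x \in `[(n.+2%:R)^-1, n.+2%:R].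
  move=> x0; have [N1 _ HN1] := nbhs_infty_ger x.
  have [N2 _ HN2] := nbhs_infty_ger x^-1.
  exists (maxn N1 N2) => // n /=; rewrite geq_max => /andP[n1 n2].
  rewrite in_itv /= invf_ple ?posrE ?ltr0n //.
  rewrite (le_trans (HN1 n n1)) ?(le_trans (HN2 n n2)) ?ler_nat //;
  by rewrite leqW // leqW.
have pos : (\int[mu]_(x in `]0%R, +oo[) ((pearson_poly r).[x] * w x)%:E = 0)%E.
  apply: (integral_pearson_cutoff (a := fun n => (n.+2%:R)^-1) (b := fun n => n.+2%:R))
    => //.
  - by move=> n; left.
  - move=> n x /=; rewrite !in_itv /= andbT => /andP[+ _]; exact: lt_le_trans.
  - by move=> x /=; rewrite in_itv /= andbT; exact: near_itv.
  - exact: cvg_poly_weight_infty.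
  - exact: cvg_poly_weight_0.
have evenw x : w (- x) = w x.
  by rewrite /sextic_freud_weight normrN sqrrN (exprM _ 2 3) sqrrN -exprM.
(* Reflection turns the boundary terms on the negative half-line into those of r(-x) on the positive
   one. *)
have oddF x : ('X * r).[- x] * w (- x) = - (('X * (r \Po - 'X)).[x] * w x).
  by rewrite evenw !hornerM horner_comp hornerN !hornerX !mulNr.
have neg : (\int[mu]_(x in `]-oo, 0%R[) ((pearson_poly r).[x] * w x)%:E = 0)%E.
  apply: (integral_pearson_cutoff (a := fun n => - n.+2%:R) (b := fun n => - (n.+2%:R)^-1))
    => //.
  - by move=> n; rewrite ltrN2.
  - by move=> n; right; rewrite oppr_lt0.
  - move=> n x /=; rewrite !in_itv /= => /andP[_ xn].
    by apply: le_lt_trans xn _; rewrite oppr_lt0.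
  - move=> x /=; rewrite in_itv /= => x0.
    have [N _ HN] := near_itv (- x) ltac:(by rewrite oppr_gt0).
    exists N => // n /= Nn; have := HN n Nn.
    by rewrite /= !in_itv /= lerNl lerNr andbC.
  - under eq_fun do rewrite oddF; rewrite -oppr0; apply: cvgN.
    exact: cvg_poly_weight_0.
  - under eq_fun do rewrite oddF; rewrite -oppr0; apply: cvgN.
    exact: cvg_poly_weight_infty.
have split0 : setT `\ (0 : R) = `]-oo, 0[%classic `|` `]0, +oo[%classic.
  apply/seteqP; split => x /=; rewrite !in_itv /= andbT.
    by move=> [_ /eqP]; rewrite neq_lt => /orP.
  by move=> /orP; rewrite -neq_lt => /eqP.
rewrite -(@integral_setD1 _ _ 0) split0; last 2 first.
- exact: measurableU.
- exact: measurable_funS mf.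
rewrite integral_setU //; last 2 first.
- exact: measurable_funS mf.
- apply/disj_setPS => x /=; rewrite !in_itv /= andbT => -[x0 x1].
  by have := lt_trans x0 x1; rewrite ltxx.
by rewrite [X in (X + _)%E]neg pos adde0.
Qed.
End PearsonIdentity.

(** The cubic form G, with [c] at the centre of the window. Its value at (1, 1, 1, 1, 1) is 10, the
    constant that recurs below. *)
Definition string_poly (R : nzRingType) (a b c d e : R) : R :=
  c * (a * b + b ^+ 2 + 2 * b * c + b * d + c ^+ 2 + 2 * c * d + d ^+ 2 + d * e).

Lemma sextic_freud_string_equation (R : realType) (lambda t : R) (P : nat -> {poly R})
    (beta : nat -> R) : -1 < lambda ->
    monic_orthogonal_polys (sextic_freud_weight t lambda) P ->
    recurrence_coeffs P beta ->
  (forall n, 0 < beta n.+1) /\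
  forall n, 6 * string_poly (beta n.+1) (beta n.+2) (beta n.+3) (beta n.+4)
                            (beta n.+2.+3) - 2 * t * beta n.+3
            = n.+3%:R + (2 * lambda + 1) * (odd n.+3)%:R.
Proof.
move=> lambda_gt hP [_ P0 Prec].
have iP := integrable_poly_weight hP P0.
have [Pms [h [h_gt0 orth]]] := hP.
pose w := sextic_freud_weight t lambda.
pose L (p : {poly R}) := (\int[@lebesgue_measure R]_x (p.[x] * w x))%R.
have LD p q : L (p + q) = L p + L q.
  rewrite /L -RintegralD //.
  by apply: eq_Rintegral => x _; rewrite hornerD mulrDl.
have LZ c p : L (c *: p) = c * L p.
  rewrite /L -RintegralZl //.
  by apply: eq_Rintegral => x _; rewrite hornerZ -mulrA.
have Pm n := (Pms n).1; have szP n := (Pms n).2.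
have L_orth m n : L (P m * P n) = h n * (m == n)%:R.
  rewrite /L /Rintegral; under eq_integral do rewrite hornerM.
  by rewrite orth.
have L_pearson r : L (('X * r)^`() + (2 * lambda + 1) *: r
    + 'X * r * ((2 * t) *: 'X - 6 *: 'X^5)) = 0.
  by rewrite /L /Rintegral (pearson_identity lambda_gt) //; exact: iP.
split=> [|n]; first exact: (recurrence_coeff_gt0 LD LZ Pm szP h_gt0 L_orth Prec).
have := string_equation LD LZ Pm szP h_gt0 L_orth Prec L_pearson n.
by rewrite /= !addnS !addn0 /string_poly mulrA.
Qed.

(** * Freud's limit argument *)

(** The upper limit, obtained as the infimum of the eventual upper bounds; applied to -x it also
    gives the lower limit. *)
Lemma limsup_exists (R : realType) (x : nat -> R) (X : R) :
    (forall n, `|x n| <= X) ->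
  exists A, (forall e, 0 < e -> \forall n \near \oo, x n < A + e) /\
            (forall e N, 0 < e -> exists2 n, (N <= n)%N & A - e < x n).
Proof.
move=> xX; pose S := [set c | \forall n \near \oo, x n <= c].
have S0 : S !=set0.
  by exists X; apply: nearW => n; apply: le_trans (ler_norm _) (xX n).
have Slb : has_lbound S.
  exists (- X) => c [N _ HN]; apply: le_trans (HN N (leqnn N)).
  by rewrite lerNl; apply: le_trans (xX N); rewrite -normrN ler_norm.
exists (inf S); split=> [e e0|e N e0].
  have [c [N _ HN] cA] := inf_adherent e0 (conj S0 Slb).
  by exists N => // n Nn; apply: le_lt_trans cA; exact: HN.
apply: contrapT => nex.
have : inf S <= inf S - e.
  apply: ge_inf => //; exists N => // n /= Nn; rewrite leNgt; apply/negP => H.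
  by apply: nex; exists n.
by rewrite lerDl oppr_ge0 leNgt e0.
Qed.

Lemma ler_string_poly (R : realDomainType) (a b c d e a' b' c' d' e' : R) :
  0 <= a <= a' -> 0 <= b <= b' -> 0 <= c <= c' -> 0 <= d <= d' -> 0 <= e <= e' ->
  string_poly a b c d e <= string_poly a' b' c' d' e'.
Proof.
move=> /andP[a0 aa] /andP[b0 bb] /andP[c0 cc] /andP[d0 dd] /andP[e0 ee].
rewrite /string_poly !expr2; apply: ler_pM => //.
  by rewrite !addr_ge0 ?mulr_ge0.
by do !apply: lerD; do ?apply: ler_pM; rewrite ?mulr_ge0 //; apply: ler_pM.
Qed.

Lemma cvg_string_poly (R : realType) (a b c d e : nat -> R) (a' b' c' d' e' : R) :
  a @ \oo --> a' -> b @ \oo --> b' -> c @ \oo --> c' -> d @ \oo --> d' ->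
  e @ \oo --> e' ->
  (fun n => string_poly (a n) (b n) (c n) (d n) (e n)) @ \oo
    --> string_poly a' b' c' d' e'.
Proof.
move=> ha hb hc hd he; rewrite /string_poly !expr2.
under eq_fun do rewrite !expr2.
apply: (cvgM hc).
apply: cvgD; last exact: (cvgM hd he).
apply: cvgD; last exact: (cvgM hd hd).
apply: cvgD; last exact: (cvgM (cvgM (cvg_cst _) hc) hd).
apply: cvgD; last exact: (cvgM hc hc).
apply: cvgD; last exact: (cvgM hb hd).
apply: cvgD; last exact: (cvgM (cvgM (cvg_cst _) hb) hc).
by apply: cvgD; apply: cvgM.
Qed.

(* Freud's argument: with A the upper and a the lower limit of x, evaluating
   the relation near A and near a gives
   A (A^2 + 4 A a + 5 a^2) <= 10 <= a (a^2 + 4 a A + 5 A^2),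
   that is (A - a) (A^2 + a^2) <= 0. *)
Lemma string_poly_limit (R : realType) (x : nat -> R) (X : R) :
    (forall n, 0 <= x n <= X) ->
    (fun n => string_poly (x n) (x n.+1) (x n.+2) (x n.+3) (x n.+4)) @ \oo
      --> (10 : R) ->
  x @ \oo --> (1 : R).
Proof.
move=> xX G10.
have x_ge0 n : 0 <= x n by case/andP: (xX n).
have x_le n : x n <= X by case/andP: (xX n).
have [A [A1 A2]] : exists A, (forall e, 0 < e -> \forall n \near \oo, x n < A + e) /\
            (forall e N, 0 < e -> exists2 n, (N <= n)%N & A - e < x n).
  by apply: (limsup_exists (X := X)) => n; rewrite ger0_norm.
have [a' [a1 a2]] : exists A, (forall e, 0 < e -> \forall n \near \oo, - x n < A + e) /\
            (forall e N, 0 < e -> exists2 n, (N <= n)%N & A - e < - x n).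
  by apply: (limsup_exists (X := X)) => n; rewrite normrN ger0_norm.
pose a := - a'.
have a_ge0 : 0 <= a.
  apply/ler_addgt0Pr => e e0; have [n _ H] := a2 e 0%N e0.
  by have := x_ge0 n; rewrite /a; lra.
have aA : a <= A.
  apply/ler_addgt0Pr => e e0; have e20 : 0 < e / 2 by lra.
  have [N1 _ HN1] := A1 _ e20; have [N2 _ HN2] := a1 _ e20.
  have := HN1 (maxn N1 N2) (leq_maxl _ _); have := HN2 (maxn N1 N2) (leq_maxr _ _).
  by rewrite /a /=; lra.
pose u (k : nat) : R := (k.+1%:R)^-1.
have u0 k : 0 < u k by rewrite invr_gt0.
have cu : u @ \oo --> 0 by exact: cvg_harmonic.
have cl (b : R) : (fun k => b * (1 - u k)) @ \oo --> b.
  have : (fun k => b * (1 - u k)) @ \oo --> b * (1 - 0).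
    by apply: cvgM; [exact: cvg_cst|apply: cvgB => //; exact: cvg_cst].
  by rewrite subr0 mulr1.
have cr (b : R) : (fun k => b + u k) @ \oo --> b.
  have : (fun k => b + u k) @ \oo --> b + 0 by apply: cvgD => //; exact: cvg_cst.
  by rewrite addr0.
(* A multiplicative margin keeps the lower bound nonnegative, as the monotonicity of [string_poly]
   requires. *)
have low k : \forall n \near \oo, 0 <= a * (1 - u k) <= x n.
  have u1 : u k <= 1 by rewrite invf_le1 ?ltr0n // ler1n.
  have [a0|a0] := eqVneq a 0.
    by apply: nearW => n; rewrite a0 mul0r lexx x_ge0.
  have ap : 0 < a by rewrite lt0r a0.
  have [N _ HN] := a1 _ (mulr_gt0 ap (u0 k)).
  exists N => // n Nn /=; have := HN n Nn; rewrite /= /a in ap *.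
  by rewrite mulr_ge0 ?subr_ge0 //= => H; lra.
have freqA k N : exists2 n, (N <= n)%N & 0 <= A * (1 - u k) <= x n.
  have u1 : u k <= 1 by rewrite invf_le1 ?ltr0n // ler1n.
  have A_ge0 : 0 <= A by exact: le_trans aA.
  have [A0|A0] := eqVneq A 0.
    by exists N => //; rewrite A0 mul0r lexx x_ge0.
  have Ap : 0 < A by rewrite lt0r A0.
  have [n Nn H] := A2 _ N (mulr_gt0 Ap (u0 k)); exists n => //.
  by rewrite mulr_ge0 ?subr_ge0 //=; lra.
have near2 (Q : nat -> Prop) : (\forall n \near \oo, Q n) ->
    \forall n \near \oo, [/\ Q n, Q n.+1, Q n.+2, Q n.+3 & Q n.+4].
  move=> [N _ HN]; exists N => // n /= Nn.
  by split; apply: (HN) => /=; lia.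
have G10k k : \forall n \near \oo,
    10 - u k <= string_poly (x n) (x n.+1) (x n.+2) (x n.+3) (x n.+4) <= 10 + u k.
  move/cvgrPdist_le: G10 => /(_ _ (u0 k)) [N _ HN]; exists N => // n /= Nn.
  by have := HN n Nn; rewrite /= ler_norml; lra.
have E1 : string_poly a a A a a <= 10.
  apply: (ler_cvg_to (cvg_string_poly (cl a) (cl a) (cl A) (cl a) (cl a)) (cr 10)).
  apply: nearW => k.
  have [N1 _ HN1] := near2 _ (low k); have [N2 _ HN2] := G10k k.
  (* The chosen index is to be the centre of a window, so it must be at least 2. *)
  have [[|[|n]] Nn Hn] := freqA k (maxn N1 N2).+2 => //.
  move: Nn; rewrite !ltnS geq_max => /andP[n1 n2].
  have [? ? ? ? ?] := HN1 n n1; have /andP[_ +] := HN2 n n2.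
  by apply: le_trans; apply: ler_string_poly.
have E2 : 10 <= string_poly A A a A A.
  have c10 : (fun k => 10 - u k) @ \oo --> (10 - 0 : R).
    by apply: cvgB => //; exact: cvg_cst.
  rewrite subr0 in c10.
  apply: (ler_cvg_to c10 (cvg_string_poly (cr A) (cr A) (cr a) (cr A) (cr A))).
  apply: nearW => k.
  have [N1 _ HN1] := near2 _ (A1 _ (u0 k)); have [N2 _ HN2] := G10k k.
  have [[|[|n]] Nn Hn] := a2 _ (maxn N1 N2).+2 (u0 k) => //.
  move: Nn; rewrite !ltnS geq_max => /andP[n1 n2].
  have [? ? ? ? ?] := HN1 n n1; have /andP[+ _] := HN2 n n2.
  move=> /le_trans; apply; apply: ler_string_poly; rewrite x_ge0 /= ?ltW //.
  by rewrite /a; lra.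
have Aa : A = a.
  apply/eqP; rewrite eq_le aA andbT leNgt; apply/negP => lt_aA.
  have : (A - a) * (A ^+ 2 + a ^+ 2) <= 0.
    by move: E1 E2; rewrite /string_poly; nra.
  by rewrite leNgt mulr_gt0 ?subr_gt0 // ltr_wpDr ?sqr_ge0 // exprn_gt0 //
    (le_lt_trans a_ge0).
have a1' : a = 1.
  have a3 : a ^+ 3 = 1 by move: E1 E2; rewrite Aa /string_poly; lra.
  by move/eqP: a3; rewrite pexpr_eq1 //= => /eqP.
apply/cvgrPdist_lt => e e0.
have [N1 _ HN1] := A1 _ e0; have [N2 _ HN2] := a1 _ e0.
exists (maxn N1 N2) => // n; rewrite /= geq_max => /andP[n1 n2].
have := HN1 n n1; have := HN2 n n2; rewrite /= -[a']opprK -/a Aa a1' ltr_norml.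
by move=> ? ?; apply/andP; split; lra.
Qed.

(** * The error of the truncated expansions *)

(* Iterating the hypothesis k times gives
   `|f n| <= K / (n + 1)^2 + D (31/32)^k (n + 1), and then k tends to infinity. *)
Lemma contraction_decay (R : realType) (f : nat -> R) (C D : R) (N : nat) :
    (forall n, `|f n| <= D * n.+1%:R) ->
    (forall n M, (N <= n)%N ->
       `|f n| <= M -> `|f n.+1| <= M -> `|f n.+3| <= M -> `|f n.+4| <= M ->
       `|f n.+2| <= 15 / 16 * M + C * n.+3%:R ^- 2) ->
  exists K, forall n, `|f n| <= K * n.+1%:R ^- 2.
Proof.
move=> fD fN.
pose v n : R := n.+1%:R ^- 2.
have v0 n : 0 < v n by rewrite invr_gt0 exprn_gt0.
have D0 : 0 <= D by have := le_trans (normr_ge0 _) (fD 0%N); rewrite mulr1.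
(* From 240 on, passing from 15/16 to 31/32 absorbs both the quotient of [v n] by [v n.+2] and that
   of n + 5 by n + 3. *)
pose N1 := maxn N 240.
(* The first term makes C at most K / 32, which completes 31/32 K to K; the sum settles the finitely
   many initial indices. *)
pose K := 32 * `|C| + \sum_(i < N1.+2) `|f i| / v i.
have K_ge0 : 0 <= K.
  apply: addr_ge0; first by rewrite mulr_ge0.
  by apply: sumr_ge0 => i _; rewrite divr_ge0 // ltW.
have KC : 32 * C <= K.
  apply: (@le_trans _ _ (32 * `|C|)); first by rewrite ler_pM2l // ler_norm.
  by rewrite lerDl; apply: sumr_ge0 => i _; rewrite divr_ge0 // ltW.
have Ksmall n : (n < N1.+2)%N -> `|f n| <= K * v n.
  move=> nN; rewrite -ler_pdivrMr // /K (bigD1 (Ordinal nN)) //= addrCA lerDl.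
  rewrite addr_ge0 // ?mulr_ge0 //.
  by apply: sumr_ge0 => i _; rewrite divr_ge0 // ltW.
exists K => n0; rewrite -/(v n0).
pose g k n := K * v n + D * (31 / 32) ^+ k * n.+1%:R.
have claim k : forall n, `|f n| <= g k n.
  elim: k => [|k IHk] n.
    by rewrite /g expr0 mulr1; apply: le_trans (fD n) _; rewrite lerDr mulr_ge0 // ltW.
  have q0 j : 0 <= D * (31 / 32) ^+ j by rewrite mulr_ge0 // exprn_ge0.
  have [nN|Nn] := ltnP n N1.+2.
    by apply: le_trans (Ksmall n nN) _; rewrite lerDl mulr_ge0.
  case: n Nn => [|[|n]] //; rewrite !ltnS => Nn.
  (* The worst case over the window: the decaying part at its left end, the growing part at its
     right end. *)
  pose M := K * v n + D * (31 / 32) ^+ k * n.+4.+1%:R.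
  have gM m : (n <= m <= n.+4)%N -> `|f m| <= M.
    move=> /andP[nm mn]; apply: le_trans (IHk m) _; apply: lerD.
      rewrite ler_wpM2l // lef_pV2 ?posrE ?exprn_gt0 //.
      by rewrite lerXn2r ?nnegrE // ler_nat.
    by rewrite ler_wpM2l // ler_nat.
  have NN : (N <= n)%N by apply: leq_trans Nn; exact: leq_maxl.
  have n240 : 240 <= n%:R :> R by rewrite ler_nat; apply: leq_trans Nn; exact: leq_maxr.
  have gM' m : (m <= 4)%N -> `|f (m + n)%N| <= M by move=> m4; apply: gM; lia.
  have := fN n M NN (gM' 0%N isT) (gM' 1%N isT) (gM' 3%N isT) (gM' 4%N isT).
  move=> H; apply: le_trans H _; rewrite -/(v n.+2) /g /M.
  have E1 : n.+1%:R = n%:R + 1 :> R by rewrite -addn1 natrD.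
  have E3 : n.+3%:R = n%:R + 3 :> R by rewrite -addn3 natrD.
  have E5 : n.+4.+1%:R = n%:R + 5 :> R by rewrite -natrD addnC.
  have v2 : 15 / 16 * v n <= 31 / 32 * v n.+2.
    rewrite /v ler_pdivrMr ?exprn_gt0 // mulrAC ler_pdivlMr ?exprn_gt0 //.
    by rewrite E1 E3; nra.
  have d2 : 15 / 16 * n.+4.+1%:R <= 31 / 32 * n.+3%:R :> R.
    by rewrite E3 E5; lra.
  have := ler_wpM2l K_ge0 v2; have := ler_wpM2l (q0 k) d2.
  have := ler_wpM2r (ltW (v0 n.+2)) KC.
  by rewrite exprS; lra.
have H : (fun k => g k n0) @ \oo --> K * v n0 + D * 0 * n0.+1%:R.
  apply: cvgD; first exact: cvg_cst.
  apply: cvgM; last exact: cvg_cst.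
  apply: cvgM; first exact: cvg_cst.
  by apply: cvg_expr; rewrite ger0_norm //; lra.
rewrite mulr0 mul0r addr0 in H.
by apply: (cvgr_to_ge H); apply: nearW => k; exact: claim.
Qed.

Lemma poly_bound01 (R : realDomainType) (p : {poly R}) :
  exists K, forall s, 0 <= s <= 1 -> `|p.[s]| <= K.
Proof.
exists (\sum_(i < size p) `|p`_i|) => s /andP[s0 s1].
rewrite horner_coef; apply: le_trans (ler_norm_sum _ _ _) _.
apply: ler_sum => i _; rewrite normrM ler_piMr // normrX ger0_norm //.
exact: exprn_ile1.
Qed.

Lemma poly_bound_small (R : realDomainType) (k : nat) (p : {poly R}) :
    (forall i, (i < k)%N -> p`_i = 0) ->
  exists K, forall s, 0 <= s <= 1 -> `|p.[s]| <= K * s ^+ k.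
Proof.
move=> p0; have [K HK] := poly_bound01 (drop_poly k p).
exists K => s s01; rewrite -{1}(poly_take_drop k p).
have -> : take_poly k p = 0.
  by apply/polyP => i; rewrite coef_take_poly coef0; case: ltnP => // /p0.
rewrite add0r hornerM hornerXn normrM [`|s ^+ k|]ger0_norm; last first.
  by rewrite exprn_ge0 //; case/andP: s01.
by rewrite ler_wpM2r ?HK // exprn_ge0 //; case/andP: s01.
Qed.

(** The factors are changed one at a time; each increment is multiplied by two factors close to 1,
    whose product is 1 up to 3 eta. *)
Lemma trilinear_approx (R : realDomainType) (eta x y z x' y' z' : R) :
    eta <= 1 -> `|x' - 1| <= eta -> `|y' - 1| <= eta ->
    `|y - 1| <= eta -> `|z - 1| <= eta ->
  `|x * y * z - x' * y' * z' - ((x - x') + (y - y') + (z - z'))|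
    <= 3 * eta * (`|x - x'| + `|y - y'| + `|z - z'|).
Proof.
move=> eta1 hx' hy' hy hz.
have prod1 (u v : R) : `|u - 1| <= eta -> `|v - 1| <= eta -> `|u * v - 1| <= 3 * eta.
  move=> hu hv; have e0 : 0 <= eta by apply: le_trans hu.
  have -> : u * v - 1 = (u - 1) * (v - 1) + ((u - 1) + (v - 1)) by ring.
  have H1 : `|(u - 1) * (v - 1)| <= eta.
    by rewrite normrM (le_trans (ler_pM _ _ hu hv)) // ler_piMr.
  have H2 := ler_normD ((u - 1) * (v - 1)) ((u - 1) + (v - 1)).
  have H3 := ler_normD (u - 1) (v - 1).
  lra.
have -> : x * y * z - x' * y' * z' - ((x - x') + (y - y') + (z - z'))
  = (x - x') * (y * z - 1) + (y - y') * (x' * z - 1) + (z - z') * (x' * y' - 1).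
  by ring.
apply: le_trans (ler_normD _ _) _; rewrite [in leRHS]mulrDr; apply: lerD; last first.
  by rewrite normrM mulrC ler_wpM2r // prod1.
apply: le_trans (ler_normD _ _) _; rewrite [in leRHS]mulrDr; apply: lerD.
  by rewrite normrM mulrC ler_wpM2r // prod1.
by rewrite normrM mulrC ler_wpM2r // prod1.
Qed.

(** Each of the eight monomials is linearised separately. The weight 16 of the centre is 10 from the
    common factor [c] plus 6 from its occurrences in the bracket. *)
Lemma string_poly_approx (R : realDomainType) (eta a b c d e a' b' c' d' e' : R) :
    eta <= 1 ->
    `|a - 1| <= eta -> `|b - 1| <= eta -> `|c - 1| <= eta -> `|d - 1| <= eta ->
    `|e - 1| <= eta ->
    `|a' - 1| <= eta -> `|b' - 1| <= eta -> `|c' - 1| <= eta -> `|d' - 1| <= eta ->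
    `|e' - 1| <= eta ->
  `|string_poly a b c d e - string_poly a' b' c' d' e'
     - (16 * (c - c') + 6 * (b - b') + 6 * (d - d') + (a - a') + (e - e'))|
  <= 3 * eta * (16 * `|c - c'| + 6 * `|b - b'| + 6 * `|d - d'| + `|a - a'| + `|e - e'|).
Proof.
move=> eta1 ha hb hc hd he ha' hb' hc' hd' he'.
pose D (x y z x' y' z' : R) := x * y * z - x' * y' * z' - ((x - x') + (y - y') + (z - z')).
have -> : string_poly a b c d e - string_poly a' b' c' d' e'
     - (16 * (c - c') + 6 * (b - b') + 6 * (d - d') + (a - a') + (e - e'))
  = D c a b c' a' b' + D c b b c' b' b' + 2 * D c b c c' b' c' + D c b d c' b' d'
    + D c c c c' c' c' + 2 * D c c d c' c' d' + D c d d c' d' d' + D c d e c' d' e'.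
  by rewrite /D /string_poly; ring.
have N2 (u : R) : `|2 * u| = 2 * `|u| by rewrite normrM ger0_norm.
have T1 : `|D c a b c' a' b'| <= _ := @trilinear_approx _ eta c a b c' a' b' eta1 hc' ha' ha hb.
have T2 : `|D c b b c' b' b'| <= _ := @trilinear_approx _ eta c b b c' b' b' eta1 hc' hb' hb hb.
have T3 : `|D c b c c' b' c'| <= _ := @trilinear_approx _ eta c b c c' b' c' eta1 hc' hb' hb hc.
have T4 : `|D c b d c' b' d'| <= _ := @trilinear_approx _ eta c b d c' b' d' eta1 hc' hb' hb hd.
have T5 : `|D c c c c' c' c'| <= _ := @trilinear_approx _ eta c c c c' c' c' eta1 hc' hc' hc hc.
have T6 : `|D c c d c' c' d'| <= _ := @trilinear_approx _ eta c c d c' c' d' eta1 hc' hc' hc hd.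
have T7 : `|D c d d c' d' d'| <= _ := @trilinear_approx _ eta c d d c' d' d' eta1 hc' hd' hd hd.
have T8 : `|D c d e c' d' e'| <= _ := @trilinear_approx _ eta c d e c' d' e' eta1 hc' hd' hd he.
have sum8 (u1 u2 u3 u4 u5 u6 u7 u8 : R) : `|u1 + u2 + 2 * u3 + u4 + u5 + 2 * u6 + u7 + u8|
    <= `|u1| + `|u2| + 2 * `|u3| + `|u4| + `|u5| + 2 * `|u6| + `|u7| + `|u8|.
  by rewrite -!N2; do 7 (apply: le_trans (ler_normD _ _) _; apply: lerD => //).
apply: le_trans (sum8 _ _ _ _ _ _ _ _) _; lra.
Qed.

(** Re-expansion at a neighbouring index: with s = m^(-1/3) and j = n - m, xi is (n / m)^(1/3) = (1
    + j s^3)^(1/3). To the needed order, with h = j s^3, xi is 1 + h/3 - h^2/9, its inverse 1 - h/3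
    and the inverse square 1 - 2h/3; in the last two terms xi counts as 1. *)
Lemma expansion_shift (R : realFieldType) (tau A B C : R) :
  exists K, forall s j xi, 0 < s <= 1 / 2 -> `|j| <= 2 -> 0 < xi ->
    xi ^+ 3 = 1 + j * s ^+ 3 ->
  `|xi + tau * s ^+ 2 / xi + A * s ^+ 3 / xi ^+ 2 + B * s ^+ 5 / xi ^+ 4
     + C * s ^+ 6 / xi ^+ 5
    - (1 + tau * s ^+ 2 + (A + j / 3) * s ^+ 3 + (B - tau * j / 3) * s ^+ 5
       + (C - j ^+ 2 / 9 - 2 * j * A / 3) * s ^+ 6)| <= K * s ^+ 7.
Proof.
exists (24 + 16 * `|tau| + 80 * `|A| + 40 * `|B| + 80 * `|C|).
move=> s j xi /andP[s0 s12] j2 xi0 xi3.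
pose h := j * s ^+ 3; pose del := xi - 1; pose y := xi^-1.
have s1 : s <= 1 by lra.
have s3 : s ^+ 3 <= 1 / 8.
  have -> : 1 / 8 = (1 / 2) ^+ 3 :> R by field.
  by rewrite lerXn2r ?nnegrE //; lra.
have s3_gt0 : 0 < s ^+ 3 by rewrite exprn_gt0.
have h2 : `|h| <= 2 * s ^+ 3 by rewrite normrM (gtr0_norm s3_gt0) ler_wpM2r // ltW.
have hE : h = del * (xi ^+ 2 + xi + 1).
  have -> : h = xi ^+ 3 - 1 by rewrite xi3 /h; ring.
  by rewrite /del; ring.
have del_h : `|del| <= `|h|.
  by rewrite hE normrM ler_peMr // ger0_norm; nra.
have del_s : `|del| <= 2 * s ^+ 3 by exact: le_trans h2.
have /andP[d1 d2] : - (1 / 4) <= del <= 1 / 4 by rewrite -ler_norml; lra.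
have yxi : y * xi = 1 by rewrite mulVf // gt_eqF.
have y0 : 0 < y by rewrite invr_gt0.
have y43 : y <= 4 / 3 by rewrite /y invf_ple ?posrE //; move: d1; rewrite /del; lra.
have del2 : `|del| ^+ 2 <= 4 * s ^+ 6.
  have -> : 4 * s ^+ 6 = (2 * s ^+ 3) ^+ 2 by ring.
  by rewrite lerXn2r ?nnegrE // mulr_ge0 // ltW.
have del3 : `|del| ^+ 3 <= 8 * s ^+ 9.
  have -> : 8 * s ^+ 9 = (2 * s ^+ 3) ^+ 3 by ring.
  by rewrite lerXn2r ?nnegrE // mulr_ge0 // ltW.
have bound (u v k1 k2 : R) : `|u| <= k1 -> `|v| <= k2 -> `|u * v| <= k1 * k2.
  by move=> *; rewrite normrM ler_pM.
have xiE : xi = 1 + del by rewrite /del; ring.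
(* The Taylor remainders in exact form, a power of [del] = O(s^3) times a bounded factor; together
   with the powers of s in front, all are O(s^7). *)
pose r1 := del ^+ 3 * ((1 + del / 3) * (2 + del + del ^+ 2 / 3) - 1 / 3).
pose r2 := del ^+ 2 * ((2 + 4 / 3 * del + del ^+ 2 / 3) * y).
pose r3 := del ^+ 2 * ((5 + 20 / 3 * del + 10 / 3 * del ^+ 2 + 2 / 3 * del ^+ 3) * y ^+ 2).
pose r4 := del * (- ((1 + xi) * (1 + xi ^+ 2)) * y ^+ 4).
pose r5 := del * (- (1 + xi + xi ^+ 2 + xi ^+ 3 + xi ^+ 4) * y ^+ 5).
have sp k : 0 < s ^+ k by rewrite exprn_gt0.
have le7 k : (7 <= k)%N -> s ^+ k <= s ^+ 7.
  by move=> k7; rewrite ler_wiXn2l // ltW.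
have -> : xi + tau * s ^+ 2 / xi + A * s ^+ 3 / xi ^+ 2 + B * s ^+ 5 / xi ^+ 4
     + C * s ^+ 6 / xi ^+ 5
    - (1 + tau * s ^+ 2 + (A + j / 3) * s ^+ 3 + (B - tau * j / 3) * s ^+ 5
       + (C - j ^+ 2 / 9 - 2 * j * A / 3) * s ^+ 6)
  = r1 + tau * s ^+ 2 * r2 + A * s ^+ 3 * r3 + B * s ^+ 5 * r4 + C * s ^+ 6 * r5.
  have nz : xi != 0 by rewrite gt_eqF.
  have e1 : r1 = xi - 1 - h / 3 + h ^+ 2 / 9 by rewrite /r1 hE xiE; field.
  have e2 : r2 = xi^-1 - 1 + h / 3.
    by rewrite /r2 hE /y /del; field.
  have e3 : r3 = xi^-1 ^+ 2 - 1 + 2 * h / 3.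
    by rewrite /r3 hE /y /del; field.
  have e4 : r4 = xi^-1 ^+ 4 - 1 by rewrite /r4 /y /del; field.
  have e5 : r5 = xi^-1 ^+ 5 - 1 by rewrite /r5 /y /del; field.
  by rewrite e1 e2 e3 e4 e5 /h -!exprVn; ring.
have yk k : y ^+ k <= (4 / 3) ^+ k by rewrite lerXn2r ?nnegrE // ltW.
have b1 : `|r1| <= 24 * s ^+ 7.
  have : `|r1| <= 8 * s ^+ 9 * 3.
    apply: (bound _ _ _ _); first by rewrite normrX.
    by rewrite ler_norml; apply/andP; split; nra.
  by have := le7 9%N isT; lra.
have b2 : `|r2| <= 16 * s ^+ 6.
  have : `|r2| <= 4 * s ^+ 6 * (3 * (4 / 3)).
    apply: (bound _ _ _ _); first by rewrite normrX.
    apply: (bound _ _ _ _); last by rewrite gtr0_norm.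
    by rewrite ler_norml; apply/andP; split; nra.
  by lra.
have b3 : `|r3| <= 80 * s ^+ 6.
  have : `|r3| <= 4 * s ^+ 6 * (9 * (4 / 3) ^+ 2).
    apply: (bound _ _ _ _); first by rewrite normrX.
    apply: (bound _ _ _ _); last by rewrite gtr0_norm ?exprn_gt0.
    by rewrite ler_norml; apply/andP; split; nra.
  by have := sp 6%N; lra.
have b4 : `|r4| <= 40 * s ^+ 3.
  have : `|r4| <= 2 * s ^+ 3 * (6 * (4 / 3) ^+ 4).
    apply: (bound _ _ _ _) => //.
    apply: (bound _ _ _ _); last by rewrite gtr0_norm ?exprn_gt0.
    by rewrite normrN xiE ger0_norm; nra.
  by have := sp 3%N; lra.
have b5 : `|r5| <= 80 * s ^+ 3.
  have : `|r5| <= 2 * s ^+ 3 * (9 * (4 / 3) ^+ 5).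
    apply: (bound _ _ _ _) => //.
    apply: (bound _ _ _ _); last by rewrite gtr0_norm ?exprn_gt0.
    by rewrite normrN xiE ger0_norm; nra.
  by have := sp 3%N; lra.
have term (k l : nat) (u v r : R) : (7 <= k + l)%N -> `|r| <= v * s ^+ l -> 0 <= v ->
    `|u * s ^+ k * r| <= v * `|u| * s ^+ 7.
  move=> kl hr v0; rewrite !normrM [`|s ^+ k|]gtr0_norm //.
  apply: (@le_trans _ _ (`|u| * s ^+ k * (v * s ^+ l))).
    by rewrite ler_wpM2l // mulr_ge0 // ltW.
  have -> : `|u| * s ^+ k * (v * s ^+ l) = v * `|u| * s ^+ (k + l).
    by rewrite exprD; ring.
  by rewrite ler_wpM2l ?le7 // mulr_ge0.
have t2 := @term 2%N 6%N tau _ _ isT b2 ltac:(lra).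
have t3 := @term 3%N 6%N A _ _ isT b3 ltac:(lra).
have t4 := @term 5%N 3%N B _ _ isT b4 ltac:(lra).
have t5 := @term 6%N 3%N C _ _ isT b5 ltac:(lra).
have sum5 (u1 u2 u3 u4 u5 : R) :
    `|u1 + u2 + u3 + u4 + u5| <= `|u1| + `|u2| + `|u3| + `|u4| + `|u5|.
  by do 4 (apply: le_trans (ler_normD _ _) _; apply: lerD => //).
apply: le_trans (sum5 _ _ _ _ _) _; lra.
Qed.

(** * The expansions as polynomials in s, and their residual in the string equation *)

Section TruncatedExpansion.
Variables (R : realFieldType) (rho tau : R).

(* With tau = t kappa^2 / 90, kappa beta_n / n^(1/3) is formally
   1 + tau s^2 + freud_coef3 s^3 + freud_coef5 s^5 + freud_coef6 s^6
   where s = n^(-1/3); the boolean is the parity of n. *)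
Definition freud_coef3 (b : bool) : R := if b then rho else - (2 / 3 * rho).
Definition freud_coef5 (b : bool) : R :=
  if b then 7 / 3 * tau * rho else - (8 / 3 * tau * rho).
Definition freud_coef6 (b : bool) : R :=
  if b then - (tau ^+ 3 / 3 + (3 * rho ^+ 2 - 1) / 18)
  else - (tau ^+ 3 / 3 - (7 * rho ^+ 2 + 1) / 18).

(* The expansion of kappa beta_{n + j} / n^(1/3) in powers of s = n^(-1/3), up
   to s^7; here b is the parity of n + j. *)
Definition shifted_expansion (b : bool) (j : R) : {poly R} :=
  Poly [:: 1; 0; tau; freud_coef3 b + j / 3; 0; freud_coef5 b - tau * j / 3;
           freud_coef6 b - j ^+ 2 / 9 - 2 * j * freud_coef3 b / 3].

(** Here the coefficients of the theorem are justified: they make the coefficients of s^0, ..., s^6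
    of the residual vanish for both parities, and a polynomial divisible by s^7 is O(s^7) on
    [0, 1]. *)
Lemma shifted_expansion_residual (b : bool) :
  exists K, forall s, 0 <= s <= 1 ->
  `|string_poly (shifted_expansion b (- 2)).[s] (shifted_expansion (~~ b) (- 1)).[s]
      (shifted_expansion b 0).[s] (shifted_expansion (~~ b) 1).[s]
      (shifted_expansion b 2).[s]
    - (10 + 10 * rho * b%:R * s ^+ 3 + 30 * tau * s ^+ 2 * (shifted_expansion b 0).[s])|
  <= K * s ^+ 7.
Proof.
pose S := shifted_expansion b (- 2) * shifted_expansion (~~ b) (- 1)
  + shifted_expansion (~~ b) (- 1) ^+ 2
  + 2%:P * shifted_expansion (~~ b) (- 1) * shifted_expansion b 0
  + shifted_expansion (~~ b) (- 1) * shifted_expansion (~~ b) 1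
  + shifted_expansion b 0 ^+ 2
  + 2%:P * shifted_expansion b 0 * shifted_expansion (~~ b) 1
  + shifted_expansion (~~ b) 1 ^+ 2
  + shifted_expansion (~~ b) 1 * shifted_expansion b 2.
pose p := shifted_expansion b 0 * S
  - (10%:P + (10 * rho * b%:R) *: 'X^3 + (30 * tau) *: ('X^2 * shifted_expansion b 0)).
have [|K HK] := @poly_bound_small _ 7 p; last first.
  exists K => s /HK; congr (`|_| <= _).
  rewrite /p /S /string_poly.
  rewrite !(hornerD, hornerN, hornerZ, hornerM, hornerXn, hornerX, hornerC, expr2).
  by move: (shifted_expansion _ _).[s] (shifted_expansion _ _).[s]
    (shifted_expansion _ _).[s] (shifted_expansion _ _).[s]
    (shifted_expansion _ _).[s] => v0 v1 v2 v3 v4; ring.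
have coef_shifted c j i : (shifted_expansion c j)`_i = nth 0 [:: 1; 0; tau;
    freud_coef3 c + j / 3; 0; freud_coef5 c - tau * j / 3;
    freud_coef6 c - j ^+ 2 / 9 - 2 * j * freud_coef3 c / 3] i by rewrite coef_Poly.
have coefS k : S`_k = \sum_(i < k.+1)
    ((shifted_expansion b (- 2))`_i * (shifted_expansion (~~ b) (- 1))`_(k - i)
  + (shifted_expansion (~~ b) (- 1))`_i * (shifted_expansion (~~ b) (- 1))`_(k - i)
  + 2 * ((shifted_expansion (~~ b) (- 1))`_i * (shifted_expansion b 0)`_(k - i))
  + (shifted_expansion (~~ b) (- 1))`_i * (shifted_expansion (~~ b) 1)`_(k - i)
  + (shifted_expansion b 0)`_i * (shifted_expansion b 0)`_(k - i)
  + 2 * ((shifted_expansion b 0)`_i * (shifted_expansion (~~ b) 1)`_(k - i))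
  + (shifted_expansion (~~ b) 1)`_i * (shifted_expansion (~~ b) 1)`_(k - i)
  + (shifted_expansion (~~ b) 1)`_i * (shifted_expansion b 2)`_(k - i)).
  by rewrite !big_split /= -!mulr_sumr -!coefM /S !expr2 -!mulrA !coefD !coefCM.
clearbody S.
have coefp k : p`_k = \sum_(i < k.+1) (shifted_expansion b 0)`_i * S`_(k - i)
   - (10 *+ (k == 0%N) + 10 * rho * b%:R * (k == 3%N)%:R
      + 30 * tau * (if (k < 2)%N then 0 else (shifted_expansion b 0)`_(k - 2))).
  by rewrite /p coefB coefM !coefD coefC coefZ coefXn coefZ coefXnM; case: eqP.
move=> k; rewrite coefp; clear p coefp.
do 7 (case: k => [_|k]; first by
  rewrite !(big_ord_recl, big_ord0) /= !coefS !(big_ord_recl, big_ord0) /= !coef_shifted /=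
    /freud_coef3 /freud_coef5 /freud_coef6; clear coefS; case: b; rewrite /=; field).
by [].
Qed.
End TruncatedExpansion.

Lemma cbrt_exp3 (R : realType) (x : R) : 0 <= x -> (x `^ (1 / 3)) ^+ 3 = x.
Proof.
by move=> x0; rewrite -powR_mulrn ?powR_ge0 // -powRrM mul1r mulVf ?powRr1 // pnatr_eq0.
Qed.

Lemma powR_thirds (R : realType) (x : R) (k : nat) : 0 <= x ->
  x `^ (k%:R / 3) = (x `^ (1 / 3)) ^+ k.
Proof.
by move=> x0; rewrite -powR_mulrn ?powR_ge0 // -powRrM mul1r mulrC.
Qed.

Lemma string_polyZ (R : comNzRingType) (r a b c d e : R) :
  string_poly (r * a) (r * b) (r * c) (r * d) (r * e) = r ^+ 3 * string_poly a b c d e.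
Proof. by rewrite /string_poly; ring. Qed.

(** The neighbours have total weight 14. The linearisation error 3/100 and the bound 1/100 on [th]
    leave 15.51 |c - c'| <= 14.42 M + K, and 14.42 / 15.51 < 15/16. *)
Lemma contraction_step (R : realFieldType) (r th K M a b c d e a' b' c' d' e' : R) :
    let eta := 1 / 100 in
    `|a - 1| <= eta -> `|b - 1| <= eta -> `|c - 1| <= eta -> `|d - 1| <= eta ->
    `|e - 1| <= eta ->
    `|a' - 1| <= eta -> `|b' - 1| <= eta -> `|c' - 1| <= eta -> `|d' - 1| <= eta ->
    `|e' - 1| <= eta ->
    `|th| <= 1 / 100 ->
    string_poly a b c d e = r + th * c ->
    `|string_poly a' b' c' d' e' - (r + th * c')| <= K ->
    `|a - a'| <= M -> `|b - b'| <= M -> `|d - d'| <= M -> `|e - e'| <= M ->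
  `|c - c'| <= 15 / 16 * M + K.
Proof.
move=> eta ha hb hc hd he ha' hb' hc' hd' he' hth E E' Ma Mb Md Me.
have eta1 : eta <= 1 by rewrite /eta; lra.
have := string_poly_approx eta1 ha hb hc hd he ha' hb' hc' hd' he'.
have K0 : 0 <= K by apply: le_trans E'.
have thc : `|th * (c - c')| <= 1 / 100 * `|c - c'| by rewrite normrM ler_wpM2r.
move: E'; rewrite E !ler_norml => /andP[E1 E2] /andP[H1 H2].
move: thc; rewrite ler_norml => /andP[t1 t2].
have := Ma; have := Mb; have := Md; have := Me; rewrite !ler_norml.
move=> /andP[me1 me2] /andP[md1 md2] /andP[mb1 mb2] /andP[ma1 ma2].
rewrite /eta in H1 H2.
have [c0|c0] := lerP 0 (c - c').
  rewrite (ger0_norm c0) in t1 t2 H1 H2 *; lra.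
rewrite (ltr0_norm c0) in t1 t2 H1 H2 *; lra.
Qed.

(** * Rescaling by cube roots, and convergence of the scaled coefficients *)

Section ScaledExpansion.
Variables (R : realType) (t lambda : R).
Notation kappa := (kappa R).
Notation rho := (2 * lambda + 1).
Notation T := (t * kappa ^+ 2).
Notation tau := (T / 90).
Local Notation c n := (n%:R `^ (1 / 3)).

Definition sextic_expansion (n : nat) : R :=
  if odd n then odd_expansion t lambda n else even_expansion t lambda n.

Lemma kappa_gt0 : 0 < kappa.
Proof. exact: powR_gt0. Qed.

Lemma kappa_exp3 : kappa ^+ 3 = 60.
Proof. exact: cbrt_exp3. Qed.

Lemma cbrt_nat_gt0 n : (0 < n)%N -> 0 < c n :> R.
Proof. by move=> n0; rewrite powR_gt0 // ltr0n. Qed.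

Lemma cbrt_nat_exp3 n : c n ^+ 3 = n%:R :> R.
Proof. exact: cbrt_exp3. Qed.

Lemma cbrt_nat_ge1 n : (0 < n)%N -> 1 <= c n :> R.
Proof.
move=> n0; rewrite -(@ler_pXn2r _ 3) ?nnegrE ?powR_ge0 //.
by rewrite cbrt_nat_exp3 expr1n ler1n.
Qed.

Lemma cbrt_nat_cvg : (fun n => (c n)^-1) @ \oo --> (0 : R).
Proof.
apply/cvgrPdist_le => e e0.
have [N _ HN] := nbhs_infty_ger (e ^- 3); exists N.+1 => // n /= Nn.
have n0 : (0 < n)%N by apply: leq_trans Nn.
have cn := cbrt_nat_gt0 n0.
rewrite sub0r normrN gtr0_norm ?invr_gt0 // invf_ple ?posrE //.
rewrite -(@ler_pXn2r _ 3) ?nnegrE ?powR_ge0 ?invr_ge0 ?(ltW e0) //.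
rewrite cbrt_nat_exp3 exprVn; exact: (HN n (ltnW Nn)).
Qed.

(** Here [d] will be the cube root at the centre of the window. Apart from the combination t
    kappa^2, kappa only occurs through its cube and disappears. *)
Lemma scaled_expansionE (n : nat) (d : R) : (0 < n)%N -> 0 < d ->
  let s := d^-1 in let xi := c n / d in
  kappa * sextic_expansion n / d = xi + tau * s ^+ 2 / xi
    + freud_coef3 rho (odd n) * s ^+ 3 / xi ^+ 2
    + freud_coef5 rho tau (odd n) * s ^+ 5 / xi ^+ 4
    + freud_coef6 rho tau (odd n) * s ^+ 6 / xi ^+ 5.
Proof.
move=> n0 d0 s xi; have cn := cbrt_nat_gt0 n0.
have nR : 0 <= n%:R :> R by [].
have k0 := kappa_gt0; have k3 := kappa_exp3.
have T3 : tau ^+ 3 = t ^+ 3 * (2 / 405).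
  have -> : tau ^+ 3 = t ^+ 3 * kappa ^+ 3 ^+ 2 / 90 ^+ 3 by field.
  by rewrite k3; field.
have nz : [/\ c n != 0 :> R, d != 0 & kappa != 0] by rewrite !gt_eqF.
case: nz => cn0 dn0 kn0.
rewrite /sextic_expansion /freud_coef3 /freud_coef5 /freud_coef6 /s /xi.
have kE : kappa * (kappa ^+ 2) = 60 by rewrite -exprS.
case: (odd n); rewrite /odd_expansion /even_expansion ?(@powR_thirds _ _ 2)
   ?(@powR_thirds _ _ 4) ?(@powR_thirds _ _ 5) // T3.
- rewrite (_ : _ / d = c n / d + T / (90 * c n * d)
    + rho * (kappa * kappa ^+ 2) / (60 * c n ^+ 2 * d)
    + 7 * T * rho / (270 * c n ^+ 4 * d)
    - (2 * t ^+ 3 + 135 * (6 * lambda ^+ 2 + 6 * lambda + 1)) * (kappa * kappa ^+ 2)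
      / (270 * 270 * c n ^+ 5 * d)); last by field; rewrite cn0 dn0 kn0.
  by rewrite kE; field; rewrite cn0 dn0.
- rewrite (_ : _ / d = c n / d + T / (90 * c n * d)
    - rho * (kappa * kappa ^+ 2) / (90 * c n ^+ 2 * d)
    - 4 * T * rho / (135 * c n ^+ 4 * d)
    - (t ^+ 3 - 135 * (7 * lambda ^+ 2 + 7 * lambda + 2)) * (kappa * kappa ^+ 2)
      / (135 * 270 * c n ^+ 5 * d)); last by field; rewrite cn0 dn0 kn0.
  by rewrite kE; field; rewrite cn0 dn0.
Qed.

Lemma scaled_expansion_shift :
  exists K, forall m n : nat, (0 < m)%N -> (0 < n)%N -> (c m)^-1 <= 1 / 2 :> R ->
    `|n%:R - m%:R| <= 2 :> R ->
  `|kappa * sextic_expansion n / c m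
     - (shifted_expansion rho tau (odd n) (n%:R - m%:R)).[(c m)^-1]| <= K * (c m)^-1 ^+ 7.
Proof.
have [K1 HK1] := expansion_shift tau (freud_coef3 rho true)
   (freud_coef5 rho tau true) (freud_coef6 rho tau true).
have [K2 HK2] := expansion_shift tau (freud_coef3 rho false)
   (freud_coef5 rho tau false) (freud_coef6 rho tau false).
exists (`|K1| + `|K2|) => m n m0 n0 s12 nm2.
have cm := cbrt_nat_gt0 m0; have cn := cbrt_nat_gt0 n0.
have xi3 : (c n / c m) ^+ 3 = 1 + (n%:R - m%:R) * (c m)^-1 ^+ 3 :> R.
  rewrite exprMn exprVn !cbrt_nat_exp3; field.
  by rewrite pnatr_eq0 -lt0n.
have s0 : 0 < (c m : R)^-1 <= 1 / 2 by apply/andP; rewrite invr_gt0.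
have xi0 : 0 < c n / c m :> R by rewrite divr_gt0.
have s7 : 0 <= (c m)^-1 ^+ 7 :> R by rewrite exprn_ge0 // invr_ge0 ltW.
have H1 := HK1 _ _ _ s0 nm2 xi0 xi3; have H2 := HK2 _ _ _ s0 nm2 xi0 xi3.
rewrite scaled_expansionE // horner_Poly /=.
case: (odd n).
  apply: (@le_trans _ _ (K1 * (c m)^-1 ^+ 7)); last first.
    rewrite ler_wpM2r //; have := ler_norm K1; have := normr_ge0 K2; lra.
  apply: le_trans H1; rewrite le_eqVlt; apply/orP; left; apply/eqP.
  by congr (`|_ - _|); ring.
apply: (@le_trans _ _ (K2 * (c m)^-1 ^+ 7)); last first.
  rewrite ler_wpM2r //; have := ler_norm K2; have := normr_ge0 K1; lra.
apply: le_trans H2; rewrite le_eqVlt; apply/orP; left; apply/eqP.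
by congr (`|_ - _|); ring.
Qed.

Section Solution.
Variable beta : nat -> R.
Hypothesis beta0 : beta 0%N = 0.
Hypothesis beta_gt0 : forall n, 0 < beta n.+1.
Hypothesis string_eq : forall n,
  6 * string_poly (beta n.+1) (beta n.+2) (beta n.+3) (beta n.+4) (beta n.+2.+3)
    - 2 * t * beta n.+3 = n.+3%:R + rho * (odd n.+3)%:R.

Let x n := kappa * beta n / c n.

Lemma beta_ge0 n : 0 <= beta n.
Proof. by case: n => [|n]; rewrite ?beta0 // ltW. Qed.

Lemma scaled_beta_ge0 n : 0 <= x n.
Proof.
by rewrite divr_ge0 ?powR_ge0 // mulr_ge0 ?beta_ge0 // ltW // kappa_gt0.
Qed.

(** All five coefficients are divided by the cube root at the centre; the constant is 10 = kappa^3 /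
    6. *)
Lemma scaled_string_eq n (r := kappa / c n.+3) (s := (c n.+3)^-1) :
  string_poly (r * beta n.+1) (r * beta n.+2) (r * beta n.+3) (r * beta n.+4)
      (r * beta n.+2.+3)
  = (10 + 10 * rho * (odd n.+3)%:R * s ^+ 3) + 30 * tau * s ^+ 2 * (r * beta n.+3).
Proof.
have cn : c n.+3 != 0 :> R by rewrite gt_eqF // cbrt_nat_gt0.
have c3 := cbrt_nat_exp3 n.+3.
rewrite string_polyZ.
have -> : string_poly (beta n.+1) (beta n.+2) (beta n.+3) (beta n.+4) (beta n.+2.+3)
   = (c n.+3 ^+ 3 + rho * (odd n.+3)%:R + 2 * t * beta n.+3) / 6.
  by rewrite c3 -string_eq; field.
have t3 : 30 * tau = T / 3 by field.
rewrite t3.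
have -> : T / 3 * s ^+ 2 * (r * beta n.+3)
    = t * (kappa ^+ 3) / 3 * s ^+ 3 * beta n.+3 by rewrite /r /s; ring.
rewrite /r /s exprMn kappa_exp3; move: (odd n.+3) => b; field.
exact: cn.
Qed.

(** Dropping every nonnegative term of G but the cube of the centre gives x^3 <= 10 + 10 |rho| + |30
    tau| x. For x > Y >= 1 the right side is at most (Y - 1) x, while x^3 >= Y x. Indices 1 and 2
    lie below the first centre and are added by hand. *)
Lemma scaled_beta_bounded : exists X, forall n, 0 <= x n <= X.
Proof.
pose Y := 11 + 10 * `|rho| + `|30 * tau|.
exists (Y + x 1 + x 2) => n; rewrite scaled_beta_ge0 /=.
have Y0 : 0 <= Y by rewrite /Y !addr_ge0 // mulr_ge0.
have x1 := scaled_beta_ge0 1; have x2 := scaled_beta_ge0 2.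
case: n => [|[|[|n]]]; [|lra|lra|].
  by rewrite (_ : x 0 = 0) ?addr_ge0 // /x beta0 mulr0 mul0r.
suff : x n.+3 <= Y by lra.
pose r := kappa / c n.+3; pose s : R := (c n.+3)^-1.
have r0 : 0 <= r by rewrite divr_ge0 ?powR_ge0 // ltW // kappa_gt0.
have s0 : 0 <= s by rewrite invr_ge0 powR_ge0.
have s1 : s <= 1 by rewrite invf_le1 ?cbrt_nat_gt0 // cbrt_nat_ge1.
have xE : x n.+3 = r * beta n.+3 by rewrite /x /r mulrAC.
have : string_poly (r * beta n.+1) (r * beta n.+2) (r * beta n.+3) (r * beta n.+4)
      (r * beta n.+2.+3)
  = (10 + 10 * rho * (odd n.+3)%:R * s ^+ 3) + 30 * tau * s ^+ 2 * (r * beta n.+3).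
  exact: scaled_string_eq.
rewrite -xE => E.
have xn := scaled_beta_ge0 n.+3.
have le3 : x n.+3 ^+ 3 <= (10 + 10 * rho * (odd n.+3)%:R * s ^+ 3) + 30 * tau * s ^+ 2 * x n.+3.
  have rb k : 0 <= (0 : R) <= r * beta k by rewrite lexx mulr_ge0 ?beta_ge0.
  have xx : 0 <= x n.+3 <= x n.+3 by rewrite lexx andbT.
  rewrite -E; apply: le_trans (ler_string_poly (rb n.+1) (rb n.+2) xx (rb n.+4)
    (rb n.+2.+3)).
  by rewrite le_eqVlt /string_poly; apply/orP; left; apply/eqP; ring.
have h1 : 10 * rho * (odd n.+3)%:R * s ^+ 3 <= 10 * `|rho|.
  have s3 : 0 <= s ^+ 3 <= 1 by rewrite exprn_ge0 // exprn_ile1.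
  have [w0 w1] : 0 <= (odd n.+3)%:R * s ^+ 3 /\ (odd n.+3)%:R * s ^+ 3 <= 1.
    by case: (odd _); rewrite ?mul1r ?mul0r ?lexx ?ler01; split=> //; lra.
  have := ler_wpM2r w0 (ler_norm rho); have := ler_wpM2l (normr_ge0 rho) w1.
  by rewrite mulr1; lra.
have h2 : 30 * tau * s ^+ 2 * x n.+3 <= `|30 * tau| * x n.+3.
  rewrite ler_wpM2r //; apply: le_trans (ler_norm _) _; rewrite normrM.
  by rewrite ler_piMr // ger0_norm ?exprn_ge0 // exprn_ile1.
rewrite leNgt; apply/negP => ltY.
have Y1 : 1 <= Y by rewrite /Y; have := normr_ge0 rho; have := normr_ge0 (30 * tau); lra.
have : Y * x n.+3 <= x n.+3 ^+ 3.
  rewrite exprS mulrC ler_wpM2l // expr2; apply: (@le_trans _ _ (x n.+3)); first exact: ltW.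
  by rewrite ler_peMr //; lra.
have : x n.+3 ^+ 3 <= 10 + 10 * `|rho| + `|30 * tau| * x n.+3 by lra.
have : (10 + 10 * `|rho|) * 1 <= (10 + 10 * `|rho|) * x n.+3.
  by rewrite ler_wpM2l ?addr_ge0 ?mulr_ge0 //; lra.
rewrite /Y; lra.
Qed.

Lemma ler_cbrt_nat m n : (m <= n)%N -> c m <= c n :> R.
Proof. by move=> mn; rewrite ge0_ler_powR ?nnegrE // ler_nat. Qed.

(** In x each term is divided by its own cube root. By monotonicity G is then squeezed between the
    values scaled throughout by the last and by the first cube root of the window, and both are 10 +
    O(n^(-1/3)). *)
Lemma scaled_beta_cvg : x @ \oo --> (1 : R).
Proof.
have [X HX] := scaled_beta_bounded.
(* The shift starts the window at index 1, as in the string equation. *)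
rewrite -cvg_shiftS; apply: (@string_poly_limit _ _ X) => [n|]; first exact: HX.
have k0 := kappa_gt0.
have X0 : 0 <= X by have /andP[] := HX 0%N; exact: le_trans.
pose K := 10 * (2 + `|rho| + 2 * `|t| * X / kappa).
have K0 : 0 <= K by rewrite /K !(mulr_ge0, addr_ge0, invr_ge0) // ltW.
suff H n : `|10 - string_poly (x n.+1) (x n.+2) (x n.+3) (x n.+4) (x n.+2.+3)|
    <= 3 * K * (c n.+1)^-1.
  apply/cvgrPdist_le => e e0.
  have e1 : 0 < e / (3 * K + 1) by rewrite divr_gt0 //; lra.
  have /cvgrPdist_le/(_ _ e1)[N _ HN] := cbrt_nat_cvg.
  exists N => // n /= Nn; apply: le_trans (H n) _.
  have := HN n.+1 (leqW Nn); rewrite /= sub0r normrN ger0_norm ?invr_ge0 ?powR_ge0 //.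
  rewrite ler_pdivlMr; last lra.
  have : 0 <= (c n.+1 : R)^-1 by rewrite invr_ge0 powR_ge0.
  lra.
pose B := string_poly (beta n.+1) (beta n.+2) (beta n.+3) (beta n.+4) (beta n.+2.+3).
pose q := rho * (odd n.+3)%:R + 2 * t * beta n.+3.
have BE : 60 * B = 10 * (n.+3%:R + q) by have := string_eq n; rewrite -/B /q; lra.
have qK : 10 * (2 + `|q|) <= K * c n.+3.
  have c1 : 1 <= c n.+3 :> R by exact: cbrt_nat_ge1.
  have bX : beta n.+3 <= X / kappa * c n.+3.
    have /andP[_] := HX n.+3; rewrite /x ler_pdivrMr ?cbrt_nat_gt0 //.
    by move=> ?; rewrite mulrAC ler_pdivlMr // mulrC.
  have q1 : `|q| <= `|rho| + 2 * `|t| * beta n.+3.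
    apply: le_trans (ler_normD _ _) _; apply: lerD.
      by rewrite normrM; case: (odd _); rewrite ?normr1 ?normr0 ?mulr1 ?mulr0.
    by rewrite !normrM (ger0_norm (beta_ge0 _)) ger0_norm.
  have h1 : 2 * `|t| * beta n.+3 <= 2 * `|t| * (X / kappa * c n.+3).
    by rewrite ler_wpM2l // mulr_ge0.
  have h2 : (2 + `|rho|) * 1 <= (2 + `|rho|) * c n.+3 by rewrite ler_wpM2l // addr_ge0.
  rewrite /K; lra.
clearbody K q.
have ratio i m : (0 < i)%N -> (0 < m)%N ->
    kappa / c m * beta i = x i * (c i / c m).
  by move=> i0 m0; rewrite /x; field; rewrite !gt_eqF ?cbrt_nat_gt0.
have low i : (n < i <= n.+2.+3)%N -> 0 <= kappa / c n.+2.+3 * beta i <= x i.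
  move=> /andP[ni i5]; have i0 : (0 < i)%N by apply: leq_trans ni.
  rewrite mulr_ge0 ?beta_ge0 ?divr_ge0 ?powR_ge0 ?(ltW k0) //= ratio //.
  rewrite ler_piMr ?scaled_beta_ge0 // ler_pdivrMr ?cbrt_nat_gt0 // [leRHS]mul1r.
  exact: ler_cbrt_nat.
have high i : (n < i <= n.+2.+3)%N -> 0 <= x i <= kappa / c n.+1 * beta i.
  move=> /andP[ni i5]; have i0 : (0 < i)%N by apply: leq_trans ni.
  rewrite scaled_beta_ge0 /= ratio //.
  rewrite ler_peMr ?scaled_beta_ge0 // ler_pdivlMr ?cbrt_nat_gt0 // [leLHS]mul1r.
  exact: ler_cbrt_nat.
have in1 : (n < n.+1 <= n.+2.+3)%N by lia.
have in2 : (n < n.+2 <= n.+2.+3)%N by lia.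
have in3 : (n < n.+3 <= n.+2.+3)%N by lia.
have in4 : (n < n.+4 <= n.+2.+3)%N by lia.
have in5 : (n < n.+2.+3 <= n.+2.+3)%N by lia.
have := ler_string_poly (low _ in1) (low _ in2) (low _ in3) (low _ in4) (low _ in5).
have := ler_string_poly (high _ in1) (high _ in2) (high _ in3) (high _ in4) (high _ in5).
set sp := string_poly (x _) _ _ _ _.
rewrite !string_polyZ -/B !exprMn kappa_exp3 !exprVn !cbrt_nat_exp3.
rewrite [_ / n.+1%:R * B]mulrAC [_ / n.+2.+3%:R * B]mulrAC BE.
rewrite ler_pdivlMr ?ltr0n // ler_pdivrMr ?ltr0n //.
have c1 := cbrt_nat_gt0 (ltn0Sn n).
have c31 : c n.+3 <= 3 * c n.+1 :> R.
  rewrite -(@ler_pXn2r _ 3) ?nnegrE ?powR_ge0 ?mulr_ge0 ?powR_ge0 //.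
  rewrite exprMn !cbrt_nat_exp3 -natrX -natrM ler_nat; lia.
have E1 : n.+1%:R = n%:R + 1 :> R by rewrite -addn1 natrD.
have E3 : n.+3%:R = n%:R + 3 :> R by rewrite -addn3 natrD.
have E5 : n.+2.+3%:R = n%:R + 5 :> R by rewrite -natrD addnC.
have E1c : n.+1%:R = c n.+1 ^+ 3 :> R by rewrite cbrt_nat_exp3.
have n0 : 0 <= n%:R :> R by [].
have := ler_norm q; have := ler_norm (- q); rewrite normrN.
move: c1 c31 E1c; clearbody sp; set u : R := c n.+1; set v : R := c n.+3.
have u1 : 1 <= u by exact: cbrt_nat_ge1.
move: qK; rewrite -/v; move: u v u1 => u v u1; rewrite E3 E5 E1.
move=> qK u0 uv uE qN qP S1 S2.
have Kv : K * v <= 3 * K * u by have := ler_wpM2l K0 uv; lra.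
have R1 : (sp - 10) * (n%:R + 1) <= 3 * K * u by lra.
have R2 : (10 - sp) * (n%:R + 5) <= 3 * K * u by lra.
have uu : 3 * K * u <= 3 * K * u^-1 * (n%:R + 1).
  rewrite uE exprSr mulrA [_ * u^-1 * _]mulrAC; apply: ler_wpM2r; first exact: ltW.
  rewrite -mulrA; apply: ler_peMr; first lra.
  by rewrite exprS expr1 -mulrA [u * u^-1]mulfV ?mulr1 // gt_eqF.
have w0 : 0 <= 3 * K * u^-1 by rewrite mulr_ge0 ?invr_ge0 ?(ltW u0) //; lra.
rewrite ler_norml; apply/andP; split.
  have : (sp - 10) * (n%:R + 1) <= 3 * K * u^-1 * (n%:R + 1) by lra.
  by rewrite ler_pM2r; lra.
have : (10 - sp) * (n%:R + 5) <= 3 * K * u^-1 * (n%:R + 5).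
  have := ler_wpM2l w0 (_ : n%:R + 1 <= n%:R + 5); lra.
by rewrite ler_pM2r; lra.
Qed.

Let err n := kappa * (beta n - sextic_expansion n).

Lemma scaled_errE m n : (0 < m)%N ->
  kappa / c m * beta n - kappa * sextic_expansion n / c m = err n * (c m)^-1.
Proof. by move=> m0; rewrite /err; ring. Qed.

(** The a priori bound to start the contraction from: after division by the cube root of n both
    terms are bounded, and that root is at most n + 1. Index 0 cannot be rescaled and is covered by
    its own summand. *)
Lemma err_bounded : exists D, forall n, `|err n| <= D * n.+1%:R.
Proof.
have [X HX] := scaled_beta_bounded.
have [K1 HK1] := poly_bound01 (shifted_expansion rho tau true 0).
have [K2 HK2] := poly_bound01 (shifted_expansion rho tau false 0).
exists (`|err 0| + X + `|K1| + `|K2|) => n.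
have X0 : 0 <= X by have /andP[] := HX 0%N; exact: le_trans.
have D0 : 0 <= `|err 0| + X + `|K1| + `|K2| by rewrite !addr_ge0.
case: n => [|n]; first by rewrite mulr1 -!addrA lerDl !addr_ge0.
have cn := cbrt_nat_gt0 (ltn0Sn n); have c1 := cbrt_nat_ge1 (ltn0Sn n).
have s01 : 0 <= (c n.+1 : R)^-1 <= 1 by rewrite invr_ge0 ltW //= invf_le1.
have cn3 : c n.+1 <= n.+2%:R :> R.
  apply: (@le_trans _ _ n.+1%:R); last by rewrite ler_nat.
  by rewrite -[leRHS]cbrt_nat_exp3 ler_eXnr.
have : `|err n.+1 * (c n.+1)^-1| <= `|err 0| + X + `|K1| + `|K2|.
  rewrite -scaled_errE // (_ : kappa / _ * _ = x n.+1); last by rewrite /x mulrAC.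
  rewrite scaled_expansionE // divff ?gt_eqF //.
  apply: le_trans (ler_normB _ _) _.
  have /andP[x0 xX] := HX n.+1; rewrite (ger0_norm x0).
  have H1 := HK1 _ s01; have H2 := HK2 _ s01.
  have e0 := normr_ge0 (err 0); have k1 := ler_norm K1; have k2 := ler_norm K2.
  have k10 := normr_ge0 K1; have k20 := normr_ge0 K2.
  set E := (X in x n.+1 + `|X|).
  have : `|E| <= `|K1| + `|K2|.
    have -> : E = (shifted_expansion rho tau (odd n.+1) 0).[(c n.+1)^-1].
      by rewrite /E horner_Poly /= invr1 !expr1n !mulr1; field.
    case: (odd n.+1); first lra.
    lra.
  lra.
rewrite normrM [`|_^-1|]gtr0_norm ?invr_gt0 // ler_pdivrMr // => H.
by apply: le_trans H _; rewrite ler_wpM2l.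
Qed.

End Solution.
End ScaledExpansion.

(** * Contraction and decay of the error *)

Section ErrorDecay.
Variables (R : realType) (t lambda : R).
Notation kappa := (kappa R).
Notation rho := (2 * lambda + 1).
Notation tau := (t * kappa ^+ 2 / 90).
Local Notation c n := (n%:R `^ (1 / 3)).

Lemma shifted_expansion_approx1 : exists K, forall b j s, `|j| <= 2 -> 0 <= s <= 1 ->
  `|(shifted_expansion rho tau b j).[s] - 1| <= K * s.
Proof.
exists (`|tau| + \sum_(b : bool) (3 * `|freud_coef3 rho b| + `|freud_coef5 rho tau b|
  + `|freud_coef6 rho tau b|) + `|tau| + 2).
move=> b j s j2 /andP[s0 s1].
rewrite horner_Poly /=.
have : 3 * `|freud_coef3 rho b| + `|freud_coef5 rho tau b| + `|freud_coef6 rho tau b|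
  <= \sum_(b : bool) (3 * `|freud_coef3 rho b| + `|freud_coef5 rho tau b|
       + `|freud_coef6 rho tau b|).
  by rewrite (bigD1 b) //= lerDl; apply: sumr_ge0 => i _; rewrite !addr_ge0 // mulr_ge0.
move: (freud_coef3 rho b) (freud_coef5 rho tau b) (freud_coef6 rho tau b) (\sum_(_ : bool) _).
move: tau => T0 A B C S hS.
rewrite (_ : _ - 1 = (T0 * s ^+ 1 + (A + j / 3) * s ^+ 2
   + (B - T0 * j / 3) * s ^+ 4 + (C - j ^+ 2 / 9 - 2 * j * A / 3) * s ^+ 5) * s);
  last by ring.
rewrite normrM (ger0_norm s0) ler_wpM2r //.
have pw (u : R) k : `|u * s ^+ k| <= `|u|.
  by rewrite normrM ler_piMr // ger0_norm ?exprn_ge0 // exprn_ile1.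
have T_ge0 := normr_ge0 T0; have A_ge0 := normr_ge0 A; have j_ge0 := normr_ge0 j.
have a2 : `|A + j / 3| <= `|A| + 1.
  by apply: le_trans (ler_normD _ _) _; rewrite normrM normfV normr_nat; lra.
have a3 : `|B - T0 * j / 3| <= `|B| + `|T0|.
  apply: le_trans (ler_normB _ _) _; rewrite lerD2l !normrM !normfV !normr_nat.
  by have := ler_wpM2l T_ge0 j2; lra.
have a4 : `|C - j ^+ 2 / 9 - 2 * j * A / 3| <= `|C| + 1 + 2 * `|A|.
  apply: le_trans (ler_normB _ _) _; apply: lerD.
    apply: le_trans (ler_normB _ _) _; rewrite lerD2l normrM normrX normfV normr_nat.
    have : `|j| ^+ 2 <= 2 ^+ 2 by rewrite lerXn2r ?nnegrE.
    lra.
  rewrite !normrM !normfV !normr_nat.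
  by have := ler_wpM2r A_ge0 j2; lra.
apply: (@le_trans _ _ (`|T0| + (`|A| + 1) + (`|B| + `|T0|) + (`|C| + 1 + 2 * `|A|))).
  apply: le_trans (ler_normD _ _) _; apply: lerD; last exact: le_trans (pw _ _) a4.
  apply: le_trans (ler_normD _ _) _; apply: lerD; last exact: le_trans (pw _ _) a3.
  apply: le_trans (ler_normD _ _) _; apply: lerD; last exact: le_trans (pw _ _) a2.
  exact: pw.
lra.
Qed.

Variable beta : nat -> R.
Hypothesis beta0 : beta 0%N = 0.
Hypothesis beta_gt0 : forall n, 0 < beta n.+1.
Hypothesis string_eq : forall n,
  6 * string_poly (beta n.+1) (beta n.+2) (beta n.+3) (beta n.+4) (beta n.+2.+3)
    - 2 * t * beta n.+3 = n.+3%:R + rho * (odd n.+3)%:R.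

Let x n := kappa * beta n / c n.
Let err n := kappa * (beta n - sextic_expansion t lambda n).

Lemma inv_sqr_shift n : (0 < n)%N -> n%:R ^- 2 <= 4 * n.+1%:R ^- 2 :> R.
Proof.
move=> n0; have nR : 1 <= n%:R :> R by rewrite ler1n.
have -> : n.+1%:R = n%:R + 1 :> R by rewrite -addn1 natrD.
have n_gt0 : 0 < n%:R :> R by lra.
have n1_gt0 : 0 < n%:R + 1 :> R by lra.
rewrite ler_pdivlMr ?exprn_gt0 // mulrC ler_pdivrMr ?exprn_gt0 //.
by nra.
Qed.

Lemma window_bounds p k : (k < 5)%N -> (p < k.+1 + p <= p.+2.+3)%N.
Proof. lia. Qed.

Lemma window_dist p i : (p < i <= p.+2.+3)%N -> `|i%:R - p.+3%:R| <= 2 :> R.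
Proof.
  move=> /andP[i1 i2]; rewrite ler_norml.
  have -> : p.+3%:R = p%:R + 3 :> R by rewrite -natrD addn3.
  have h1 : p%:R + 1 <= i%:R :> R by rewrite -(natrD _ p 1) ler_nat addn1.
  have h5 : i%:R <= p%:R + 5 :> R by rewrite -(natrD _ p 5) ler_nat addnC.
  by apply/andP; split; lra.
Qed.

(** On the window centred at [m], beta is compared with the polynomials [v i] in s, which differ
    from the scaled truncated expansions by O(s^7); [contraction_step] applies to this pair, and
    division by s returns to [err]. *)
Lemma err_contraction : exists C N, forall n M, (N <= n)%N ->
  `|err n| <= M -> `|err n.+1| <= M -> `|err n.+3| <= M -> `|err n.+4| <= M ->
  `|err n.+2| <= 15 / 16 * M + C * n.+3%:R ^- 2.
Proof.
have [K1 HK1] := scaled_expansion_shift t lambda.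
have [Kt HKt] := shifted_expansion_residual rho tau true.
have [Kf HKf] := shifted_expansion_residual rho tau false.
have [Kv HKv] := shifted_expansion_approx1.
pose K2 := `|Kt| + `|Kf|.
(* s D <= 1 bounds s by 1/400, and both |30 tau| s and |Kv| s by 1/100, the tolerances of
   [contraction_step]. *)
pose D := 400 + 100 * `|30 * tau| + 100 * `|Kv|.
have D0 : 0 < D by rewrite /D; have := normr_ge0 (30 * tau); have := normr_ge0 Kv; lra.
have e1 : 0 < D^-1 by rewrite invr_gt0.
have e2 : 0 < 1 / 400 :> R by lra.
have /cvgrPdist_le/(_ _ e1)[N1 _ HN1] := @cbrt_nat_cvg R.
have /cvgrPdist_le/(_ _ e2)[N2 _ HN2] := scaled_beta_cvg beta0 beta_gt0 string_eq.
(* One |K1| comes from the neighbours, one from the centre, and [K2] is the residual; the 4 pays for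
   replacing m by m + 1. *)
exists (4 * (2 * `|K1| + K2)), (maxn 1 (maxn N1 N2)) => n M.
rewrite !geq_max => /and3P[]; case: n => // p _ pN1 pN2 M0 M1 M3 M4.
pose m := p.+3; pose s : R := (c m)^-1.
have cm : 0 < c m :> R by exact: cbrt_nat_gt0.
have s_gt0 : 0 < s by rewrite invr_gt0.
have sD : s * D <= 1.
  rewrite -ler_pdivlMr // mul1r; have := HN1 m (leq_trans pN1 (leqW (leqW (leqnn _)))).
  by rewrite /= sub0r normrN gtr0_norm.
have sT : 0 <= s * `|30 * tau| by rewrite mulr_ge0 // ltW.
have sK : 0 <= s * `|Kv| by rewrite mulr_ge0 // ltW.
have s400 : s <= 1 / 400 by move: sD; rewrite /D; lra.
have s1 : s <= 1 by lra.
have s12 : s <= 1 / 2 by lra.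
have s01 : 0 <= s <= 1 by rewrite ltW.
have s2 : s ^+ 2 <= s by rewrite ler_iXnr // ltW.
have s3 : s ^+ 3 <= s by rewrite ler_iXnr // ltW.
have s3_ge0 : 0 <= s ^+ 3 by rewrite exprn_ge0 // ltW.
have s7 : 0 <= s ^+ 7 by rewrite exprn_ge0 // ltW.
have near_i i : (p < i <= p.+2.+3)%N -> `|i%:R - m%:R| <= 2 :> R.
  exact: window_dist.
pose v i : R := (shifted_expansion rho tau (odd i) (i%:R - m%:R)).[s].
have v1 i : (p < i <= p.+2.+3)%N -> `|v i - 1| <= 1 / 100.
  move=> hi; apply: le_trans (HKv _ _ _ (near_i i hi) s01) _.
  have := ler_wpM2r (ltW s_gt0) (ler_norm Kv); move: sD; rewrite /D; lra.
have b1 i : (p < i <= p.+2.+3)%N -> `|kappa / c m * beta i - 1| <= 1 / 100.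
  move=> hi; have i0 : (0 < i)%N by case/andP: hi => + _; exact: leq_trans.
  have ci : 0 < c i :> R by exact: cbrt_nat_gt0.
  pose xi : R := c i / c m; have xi0 : 0 < xi by rewrite divr_gt0.
  have -> : kappa / c m * beta i = x i * xi.
    by rewrite /x /xi; field; rewrite !gt_eqF.
  have xi3 : (xi - 1) * (xi ^+ 2 + xi + 1) = (i%:R - m%:R) * s ^+ 3.
    rewrite (_ : _ * _ = xi ^+ 3 - 1); last by ring.
    rewrite /xi /s exprMn exprVn !cbrt_nat_exp3; field.
    by rewrite pnatr_eq0.
  have xi1 : `|xi - 1| <= 2 * s.
    apply: (@le_trans _ _ `|(xi - 1) * (xi ^+ 2 + xi + 1)|).
      have q1 : 1 <= xi ^+ 2 + xi + 1 by rewrite lerDr addr_ge0 ?sqr_ge0 // ltW.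
      by rewrite normrM ler_peMr // (le_trans q1) // ler_norm.
    rewrite xi3 normrM (ger0_norm s3_ge0).
    by apply: ler_pM => //; exact: near_i.
  (* With xi <= 2 and |xi - 1| <= 2 s <= 2/400, this adds up to 1/100. *)
  have x1 : `|x i - 1| <= 1 / 400.
    rewrite distrC; apply: HN2; apply: leq_trans pN2 _; by case/andP: hi.
  have -> : x i * xi - 1 = (x i - 1) * xi + (xi - 1) by ring.
  apply: le_trans (ler_normD _ _) _; rewrite normrM (gtr0_norm xi0).
  have xi2 : xi <= 2 by move: xi1; rewrite ler_norml; lra.
  have := ler_pM (normr_ge0 _) (ltW xi0) x1 xi2; lra.
have d1 i : (p < i <= p.+2.+3)%N ->
    `|kappa / c m * beta i - v i - err i * s| <= `|K1| * s ^+ 7.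
  move=> hi; have i0 : (0 < i)%N by case/andP: hi => + _; exact: leq_trans.
  have -> : kappa / c m * beta i - v i - err i * s
      = kappa * sextic_expansion t lambda i / c m - v i.
    by move: (v i) => vi; rewrite /err /s; ring.
  apply: (@le_trans _ _ (K1 * s ^+ 7)); last by rewrite ler_wpM2r // ler_norm.
  by apply: HK1 => //; exact: near_i.
have in1 : (p < p.+1 <= p.+2.+3)%N := window_bounds p (isT : 0 < 5)%N.
have in2 : (p < p.+2 <= p.+2.+3)%N := window_bounds p (isT : 1 < 5)%N.
have in3 : (p < p.+3 <= p.+2.+3)%N := window_bounds p (isT : 2 < 5)%N.
have in4 : (p < p.+4 <= p.+2.+3)%N := window_bounds p (isT : 3 < 5)%N.
have in5 : (p < p.+2.+3 <= p.+2.+3)%N := window_bounds p (isT : 4 < 5)%N.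
have nbr i : (p < i <= p.+2.+3)%N -> `|err i| <= M ->
    `|kappa / c m * beta i - v i| <= M * s + `|K1| * s ^+ 7.
  move=> hi eM; have := d1 i hi; have := ler_wpM2r (ltW s_gt0) eM => H1 H2.
  have -> : kappa / c m * beta i - v i
    = err i * s + (kappa / c m * beta i - v i - err i * s) by ring.
  apply: le_trans (ler_normD _ _) _; apply: lerD => //.
  by rewrite normrM (gtr0_norm s_gt0).
have vres : `|string_poly (v p.+1) (v p.+2) (v p.+3) (v p.+4) (v p.+2.+3)
    - (10 + 10 * rho * (odd m)%:R * s ^+ 3 + 30 * tau * s ^+ 2 * v p.+3)| <= K2 * s ^+ 7.
  have n1 : p.+1%:R = p%:R + 1 :> R by rewrite -addn1 natrD.
  have n2 : p.+2%:R = p%:R + 2 :> R by rewrite -natrD addnC.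
  have n3 : p.+3%:R = p%:R + 3 :> R by rewrite -natrD addnC.
  have n4 : p.+4%:R = p%:R + 4 :> R by rewrite -natrD addnC.
  have n5 : p.+2.+3%:R = p%:R + 5 :> R by rewrite -natrD addnC.
  have -> : v p.+1 = (shifted_expansion rho tau (odd m) (- 2)).[s].
    by rewrite /v /m /= negbK (_ : p.+1%:R - p.+3%:R = - 2) // n1 n3; ring.
  have -> : v p.+2 = (shifted_expansion rho tau (~~ odd m) (- 1)).[s].
    by rewrite /v /m /= !negbK (_ : p.+2%:R - p.+3%:R = - 1) // n2 n3; ring.
  have -> : v p.+3 = (shifted_expansion rho tau (odd m) 0).[s] by rewrite /v subrr.
  have -> : v p.+4 = (shifted_expansion rho tau (~~ odd m) 1).[s].
    by rewrite /v /m /= (_ : p.+4%:R - p.+3%:R = 1) // n4 n3; ring.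
  have -> : v p.+2.+3 = (shifted_expansion rho tau (odd m) 2).[s].
    by rewrite /v /m /= negbK (_ : p.+2.+3%:R - p.+3%:R = 2) // n5 n3; ring.
  apply: (@le_trans _ _ ((if odd m then Kt else Kf) * s ^+ 7)).
    by case: (odd m); [exact: HKt|exact: HKf].
  rewrite ler_wpM2r // /K2; case: (odd m).
    by apply: le_trans (ler_norm _) _; rewrite lerDl.
  by apply: le_trans (ler_norm _) _; rewrite lerDr.
have th : `|30 * tau * s ^+ 2| <= 1 / 100.
  rewrite normrM [`|s ^+ 2|]ger0_norm ?exprn_ge0 ?(ltW s_gt0) //.
  have := ler_wpM2l (normr_ge0 (30 * tau)) s2; move: sD; rewrite /D; lra.
have step := contraction_step (b1 _ in1) (b1 _ in2) (b1 _ in3) (b1 _ in4) (b1 _ in5)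
  (v1 _ in1) (v1 _ in2) (v1 _ in3) (v1 _ in4) (v1 _ in5) th (scaled_string_eq string_eq p) vres
  (nbr _ in1 M0) (nbr _ in2 M1) (nbr _ in4 M3) (nbr _ in5 M4).
have d3 := d1 _ in3.
have ineq : `|err p.+3| * s <= (15 / 16 * M + (2 * `|K1| + K2) * s ^+ 6) * s.
  rewrite -{1}(gtr0_norm s_gt0) -normrM.
  have -> : err p.+3 * s = (kappa / c m * beta p.+3 - v p.+3)
    - (kappa / c m * beta p.+3 - v p.+3 - err p.+3 * s) by ring.
  apply: le_trans (ler_normB _ _) _.
  have : 0 <= `|K1| * s ^+ 7 by rewrite mulr_ge0.
  rewrite mulrDl -[_ * s ^+ 6 * s]mulrA -exprSr; lra.
rewrite ler_pM2r // in ineq; apply: le_trans ineq _; apply: lerD => //.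
have K0 : 0 <= 2 * `|K1| + K2 by rewrite !addr_ge0 ?mulr_ge0.
have s6 : s ^+ 6 <= 4 * p.+4%:R ^- 2.
  by rewrite /s exprVn (exprM _ 3 2) cbrt_nat_exp3; exact: inv_sqr_shift.
by apply: le_trans (ler_wpM2l K0 s6) _; rewrite mulrCA mulrA.
Qed.

Lemma err_decay : exists K, forall n, `|err n| <= K * n.+1%:R ^- 2.
Proof.
have [D HD] := err_bounded beta0 beta_gt0 string_eq; have [C [N HN]] := err_contraction.
exact: contraction_decay HD HN.
Qed.

End ErrorDecay.

Lemma eqO_inv_sqr (R : realType) (A : set nat) (f : nat -> R) (K : R) :
  (forall n, A n -> `|f n| <= K * n.+1%:R ^- 2) ->
  f =O_ (within A \oo) (fun n : nat => n%:R ^- 2 : R).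
Proof.
move=> HK; apply/eqO_exP; exists (`|K| + 1); first by rewrite ltr_wpDl.
rewrite near_withinE; near=> n => An.
have n0 : (0 < n)%N by near: n; exact: nbhs_infty_gt.
apply: le_trans (HK n An) _.
have i0 (k : nat) : 0 <= k%:R ^- 2 :> R by rewrite invr_ge0 exprn_ge0.
rewrite (ger0_norm (i0 n)); apply: (@le_trans _ _ ((`|K| + 1) * n.+1%:R ^- 2)).
  by rewrite ler_wpM2r //; have := ler_norm K; lra.
rewrite ler_wpM2l ?addr_ge0 // lef_pV2 ?posrE ?exprn_gt0 ?ltr0n //.
by rewrite lerXn2r ?nnegrE // ler_nat.
Unshelve. all: by end_near. Qed.

Theorem theorem4p9 (R : realType) (lambda t : R) (hlambda : -1 < lambda)
    (P : nat -> {poly R}) (beta : nat -> R)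
    (hP : monic_orthogonal_polys (sextic_freud_weight t lambda) P)
    (hbeta : recurrence_coeffs P beta) :
  ((fun n : nat => beta n - even_expansion t lambda n)
    =O_ (within [set n | ~~ odd n] \oo) (fun n : nat => n%:R ^- 2 : R))
  /\
  ((fun n : nat => beta n - odd_expansion t lambda n)
    =O_ (within [set n | odd n] \oo) (fun n : nat => n%:R ^- 2 : R)).
Proof.
have [beta_gt0 string_eq] := sextic_freud_string_equation hlambda hP hbeta.
have [beta0 _ _] := hbeta.
have [K HK] := err_decay beta0 beta_gt0 string_eq.
have k0 := @kappa_gt0 R.
have H n : `|beta n - sextic_expansion t lambda n| <= K / kappa R * n.+1%:R ^- 2.
  rewrite mulrAC ler_pdivlMr // mulrC -{1}(gtr0_norm k0) -normrM.
  exact: HK.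
split; apply: (@eqO_inv_sqr _ _ _ (K / kappa R)) => n /= odd_n.
  by have := H n; rewrite /sextic_expansion (negbTE odd_n).
by have := H n; rewrite /sextic_expansion odd_n.
Qed.
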